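(* Assume that $X$ and $Y$ are finite sets and that $K$ takes positive values. Let $(a^{(\ell)},b^{(\ell)})$ be the scaling iterates $$a^{(\ell+1)}=\frac{\mathrm{prox}^{\mathrm{KL}}_{F_1/\epsilon}(\mathcal{K} b^{(\ell)})}{\mathcal{K} b^{(\ell)}},\qquad b^{(\ell+1)}=\frac{\mathrm{prox}^{\mathrm{KL}}_{F_2/\epsilon}(\mathcal{K}^{T} a^{(\ell+1)})}{\mathcal{K}^{T} a^{(\ell+1)}},\qquad \ell=0,1,2,\dots,$$ let $(u^{(\ell)},v^{(\ell)})=(\epsilon\log a^{(\ell)},\epsilon\log b^{(\ell)})$ be the associated dual iterates, and let $-I$ be the dual functional, i.e. $$I(u,v)=F_1^*(-u)+F_2^*(-v)+\epsilon\,\langle e^{(u\oplus v)/\epsilon}-1,K\rangle ,\qquad (u,v)\in L^\infty(X)^n\times L^\infty(Y)^n .$$ Let $r^{(\ell)}_k(x,y)=a^{(\ell)}_k(x)K_k(x,y)b^{(\ell)}_k(y)$ for $k=1,\dots,n$, and let $r^*$ be the minimizer of $$\min_{r\in L^1(X\times Y)^n}F_1(P^X_\# r)+F_2(P^Y_\# r)+\epsilon\,\mathrm{KL}(r|K).$$ Then $$\epsilon\,\mathrm{KL}(r^*|r^{(\ell)})\le I(u^{(\ell)},v^{(\ell)})-\inf I\le O(1/\ell).$$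
   Context: Setting: $X$ and $Y$ are endowed with probability measures $dx$ and $dy$, $X\times Y$ with the product measure $dx\,dy$; $n\ge1$; $\epsilon>0$; $K=(K_k)_{k=1}^n\in L^\infty_+(X\times Y)^n$ is a family of nonnegative bounded functions on $X\times Y$; $F_1:L^1(X)^n\to\mathbb{R}\cup\{\infty\}$ and $F_2:L^1(Y)^n\to\mathbb{R}\cup\{\infty\}$ are weakly lower semicontinuous, convex and proper. Since $X,Y$ are finite, all function spaces are finite dimensional (functions being identified almost everywhere), and $F_i^*$ is the convex conjugate with respect to the pairing $\langle r,s\rangle=\sum_k\int r_ks_k$ (integration against the corresponding reference measure). $(u\oplus v)_k(x,y)=u_k(x)+v_k(y)$; exponentials, logarithms, quotients are componentwise. $(P^X_\# r)_k(x)=\int_Y r_k(x,y)\,dy$, $(P^Y_\# r)_k(y)=\int_X r_k(x,y)\,dx$, $(\mathcal{K}b)_k(x)=\int_Y K_k(x,y)b_k(y)\,dy$, $(\mathcal{K}^{T}a)_k(y)=\int_X K_k(x,y)a_k(x)\,dx$. For families of functions $r,s$ on a measured space $(T,dt)$, $\mathrm{KL}(r|s)=\sum_k\int_T[\log(r_k/s_k)r_k-r_k+s_k]\,dt$ (with $0\log(0/0)=0$) if $r,s\ge0$ a.e. and ($s_k=0\Rightarrow r_k=0$) a.e., and $+\infty$ otherwise. $\mathrm{prox}^{\mathrm{KL}}_{F_1/\epsilon}(z)=\operatorname*{argmin}_{s:X\to\mathbb{R}^n}F_1(s)+\epsilon\,\mathrm{KL}(s|z)$, and similarly for $F_2$ on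 $Y$. The iterations are started from $b^{(0)}=e^{v^{(0)}/\epsilon}$ with some $v^{(0)}\in L^\infty(Y)^n$. The $O(1/\ell)$ means bounded by $C/\ell$ for all $\ell\ge1$, with $C$ independent of $\ell$.
   Formalization: The bound O(1/ℓ) is proved assuming that inf I is attained by some (u,v), since it can fail otherwise; the first inequality needs no such assumption. The iterates a, b are assumed positive a.e., so that u, v are finite, and the primal minimum is finite. *)

(* Defs.v *)
From HB Require Import structures.
From mathcomp Require Import all_boot all_order all_algebra.
From mathcomp Require Import all_classical all_reals all_analysis.

Set Implicit Arguments.
Unset Strict Implicit.
Unset Printing Implicit Defensive.

Import Order.TTheory GRing.Theory Num.Theory.
Import numFieldNormedType.Exports.

Local Open Scope classical_set_scope.
Local Open Scope ring_scope.

(* A probability measure on a finite set is given by its weights, some of which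
   may vanish; integrals are then weighted sums.  An element of L^1(T)^n, or of
   L^oo(T)^n, is represented by any function 'I_n -> T -> R in its class for
   equality almost everywhere, that is, equality at the points of positive
   weight. *)

Section FiniteMeasured.
Variables (R : realType) (n : nat) (T : finType) (p : T -> R).
Implicit Types (r s z w : 'I_n -> T -> R) (F : ('I_n -> T -> R) -> \bar R).

Definition prob_weights := (forall t, 0 <= p t) /\ \sum_t p t = 1.

Definition ae_eq r s := forall k t, 0 < p t -> r k t = s k t.

Definition ae_pos r := forall k t, 0 < p t -> 0 < r k t.

Definition pairing r s : R := \sum_k \sum_t p t * (r k t * s k t).

(* F is constant on classes, so it is a function on L^1(T)^n. *)
Definition ae_invariant F := forall r s, ae_eq r s -> F r = F s.

Local Open Scope ereal_scope.

Definition proper F := (forall r, F r != -oo) /\ exists r, F r < +oo.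

(* The interval is open, so 0 * +oo never occurs. *)
Definition convex F := forall r s (t : R), (0 < t < 1)%R ->
  F (fun k x => t * r k x + (1 - t) * s k x)%R
    <= t%:E * F r + (1 - t)%:E * F s.

(* In finite dimension the weak topology is the usual one.  The topology on
   'I_n -> T -> R is that of R^(n * #|T|); for an ae_invariant F, lower
   semicontinuity upstairs and on the quotient L^1(T)^n are the same. *)
Definition convex_functional F :=
  [/\ ae_invariant F, proper F, convex F
    & @lower_semicontinuous {ptws 'I_n -> {ptws T -> R}} R F].

Definition conjugate F w : \bar R :=
  ereal_sup [set (pairing w r)%:E - F r | r in [set: 'I_n -> T -> R]].

(* In a field of MathComp 0 / 0 = 0, and ln 0 = 0, so the integrand is 0 when
   r = s = 0 and s when r = 0 < s. *)
Definition KL r s : \bar R :=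
  if `[< forall k t, (0 < p t -> [/\ 0 <= r k t, 0 <= s k t
                                   & s k t = 0 -> r k t = 0])%R >]
  then (\sum_k \sum_t
          p t * (ln (r k t / s k t) * r k t - r k t + s k t))%R%:E
  else +oo.

End FiniteMeasured.

(* A problem whose value is +oo is considered to have no minimizer. *)
Definition is_argmin (R : realType) (E : Type) (G : E -> \bar R) (e : E) :=
  (G e < +oo)%E /\ forall e', (G e <= G e')%E.

(* s is a representative of prox^KL_{F/eps}(z). *)
Definition is_prox (R : realType) (n : nat) (T : finType) (p : T -> R)
    (F : ('I_n -> T -> R) -> \bar R) (eps : R) (z s : 'I_n -> T -> R) :=
  is_argmin (fun s' => (F s' + eps%:E * KL p s' z)%E) s.

Section TwoMarginals.
Variables (R : realType) (n : nat) (X Y : finType) (p : X -> R) (q : Y -> R).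
Variables (F1 : ('I_n -> X -> R) -> \bar R) (F2 : ('I_n -> Y -> R) -> \bar R).
Variables (K : 'I_n -> X * Y -> R) (eps : R).

Definition prod_weights (z : X * Y) : R := p z.1 * q z.2.

Definition margX (r : 'I_n -> X * Y -> R) : 'I_n -> X -> R :=
  fun k x => \sum_y q y * r k (x, y).

Definition margY (r : 'I_n -> X * Y -> R) : 'I_n -> Y -> R :=
  fun k y => \sum_x p x * r k (x, y).

Definition Kop (b : 'I_n -> Y -> R) : 'I_n -> X -> R :=
  fun k x => \sum_y q y * (K k (x, y) * b k y).

Definition KopT (a : 'I_n -> X -> R) : 'I_n -> Y -> R :=
  fun k y => \sum_x p x * (K k (x, y) * a k x).

Definition primal (r : 'I_n -> X * Y -> R) : \bar R :=
  (F1 (margX r) + F2 (margY r) + eps%:E * KL prod_weights r K)%E.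

(* The functional I; the dual functional is its opposite. *)
Definition neg_dual (u : 'I_n -> X -> R) (v : 'I_n -> Y -> R) : \bar R :=
  (conjugate p F1 (fun k x => - u k x)%R
   + conjugate q F2 (fun k y => - v k y)%R
   + (eps * pairing prod_weights
        (fun k z => expR ((u k z.1 + v k z.2) / eps) - 1) K)%R%:E)%E.

Definition inf_neg_dual : \bar R :=
  ereal_inf [set neg_dual uv.1 uv.2
            | uv in [set: ('I_n -> X -> R) * ('I_n -> Y -> R)]].

(* Without attainment, I(u^l, v^l) - inf I may decay slower than 1/l.  Take X of
   two points of weight 1/2, Y a point, K = 1, n = 1, F1 the indicator of
   [s0, s1 >= 0 and s0 + s1 + s0^2 <= 1] and F2 that of [t = 1/2]. *)
Definition dual_attained := exists u v, neg_dual u v = inf_neg_dual.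

(* a 0 is not used: the iterations start from b 0. *)
Definition scaling_iterates (v0 : 'I_n -> Y -> R)
    (a : nat -> 'I_n -> X -> R) (b : nat -> 'I_n -> Y -> R) :=
  ae_eq q (b 0%N) (fun k y => expR (v0 k y / eps)) /\
  forall l : nat,
    (exists2 s, is_prox p F1 eps (Kop (b l)) s
              & ae_eq p (a l.+1) (fun k x => s k x / Kop (b l) k x)) /\
    (exists2 t, is_prox q F2 eps (KopT (a l.+1)) t
              & ae_eq q (b l.+1) (fun k y => t k y / KopT (a l.+1) k y)).

Definition coupling (a : 'I_n -> X -> R) (b : 'I_n -> Y -> R) :
    'I_n -> X * Y -> R :=
  fun k z => a k z.1 * K k z * b k z.2.

End TwoMarginals.

Definition scaled_log (R : realType) (n : nat) (T : finType) (eps : R)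
    (a : 'I_n -> T -> R) : 'I_n -> T -> R :=
  fun k t => eps * ln (a k t).

(* Main.v *)
(** Fenchel-Young for F1, F2 and the entropy gives
    eps KL(rstar | r) <= I(u, v) + primal(rstar), r = K e^((u + v) / eps), so the
    first inequality says that there is no duality gap.  To see this, penalize
    the constraints s = P^X r, t = P^Y r: a minimizer of
    F1 s + F2 t + eps KL(r | K) + lam (|s - P^X r|^2 + |t - P^Y r|^2) yields,
    through the slope of the penalty, a pair (u, v) whose I(u, v) tends to
    - primal(rstar) as lam goes to infinity.  The affine minorants of F1 and F2 that
    make this coercive are the subgradients provided by the first prox steps.

    For the rate, let (u0, v0) be optimal, e = (u - u0) / eps,
    d = (v - v0) / eps, z = e + d, so that r = rstar e^z, and let g be the gap
    divided by eps.  When u is updated, with v optimal beforehand,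
    g - g' >= KL(r' | r) and g' <= <r' - r, d>; symmetrically for v.
    This gives 1/l once e and d are bounded.  As the sublevel sets of I may be
    unbounded, even modulo the shifts (u + c, v - c) that leave I invariant, this
    needs an argument: M = const - 2 <rstar, e d> controls |e|^2 + |d|^2, because
    z is bounded by KL(rstar | r) <= g.  Linearizing <r' - r, d> >= 0 around rstar
    gives M' <= M + A sqrt((g - g') g M), and g' <= B sqrt((g - g') M).
    Together they make M exp(C sqrt g) nonincreasing, hence M bounded. *)

Require Import Defs.
From HB Require Import structures.
From mathcomp Require Import all_boot all_order all_algebra.
From mathcomp Require Import all_classical all_reals all_analysis.
From mathcomp Require Import ring lra.

Import Order.TTheory GRing.Theory Num.Theory.
Import numFieldNormedType.Exports.
Local Open Scope classical_set_scope.
Local Open Scope ring_scope.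

(** * Estimates for small parameters and finite families *)

Lemma small_le0 {R : realType} (x c t0 : R) : 0 < t0 -> 0 <= c ->
  (forall t, 0 < t < t0 -> x <= c * t) -> x <= 0.
Proof.
move=> t0_gt0 c0 h; rewrite leNgt; apply/negP => x0.
pose t := Num.min (t0 / 2) (x / (2 * (1 + c))).
have D0 : 0 < 2 * (1 + c) by lra.
have tp : 0 < t by rewrite lt_min; apply/andP; split; rewrite divr_gt0.
have t1 : t < t0 by rewrite gt_min; apply/orP; left; lra.
have := h t; rewrite tp t1 => /(_ isT).
have : t * (2 * (1 + c)) <= x by rewrite -ler_pdivlMr // ge_min lexx orbT.
lra.
Qed.

(** The inverse of a sum of inverses is below each term; the added 1 covers a family without
    positive values. *)
Lemma finite_pos_lbound {R : realType} (I : finType) (f : I -> R) :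
  exists2 d : R, 0 < d & forall i, 0 < f i -> d <= f i.
Proof.
pose S := \sum_(i | 0 < f i) (f i)^-1.
have S0 : 0 <= S by rewrite sumr_ge0 // => i /ltW; rewrite invr_ge0.
have S1 : 0 < 1 + S by lra.
exists (1 + S)^-1; first by rewrite invr_gt0.
move=> i fi; rewrite -[leRHS]invrK lef_pV2 ?posrE ?invr_gt0 //.
rewrite /S (bigD1 i) //=; apply: (@le_trans _ _ (1 + (f i)^-1)); first by lra.
by rewrite lerD2l lerDl sumr_ge0 // => j /andP[/ltW fj _]; rewrite invr_ge0.
Qed.

(** * Quadratic and Lipschitz bounds for the exponential *)

Section ExpInequalities.
Context {R : realType}.
Implicit Types x y z g zeta : R.

Lemma expR_sub1Bx_ge0 z : 0 <= expR z - 1 - z.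
Proof. by have := expR_ge1Dx z; lra. Qed.

(** Square e^(z/2) >= 1 + z/2, whose right side is nonnegative for -2 <= z. *)
Lemma expR_quad_small z : -2 <= z -> z ^+ 2 / 4 <= expR z - 1 - z.
Proof.
move=> z2; have h := expR_ge1Dx (z / 2).
have -> : expR z = expR (z / 2) * expR (z / 2) by rewrite -expRD; congr expR; lra.
nra.
Qed.

(** For z >= -2 the previous bound suffices, as 4 <= 2 zeta. For z < -2 the left side is at most
    -z/2 because |z| <= zeta, and -1 - z >= -z/2. *)
Lemma expR_quad zeta z : 2 <= zeta -> - zeta <= z ->
  z ^+ 2 / (2 * zeta) <= expR z - 1 - z.
Proof.
move=> z2 hz; rewrite ler_pdivrMr; last by lra.
have [h|h] := leP (-2) z.
  have h1 := expR_quad_small z h.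
  apply: (@le_trans _ _ (z ^+ 2 / 4 * (2 * zeta))).
    by have := sqr_ge0 z; nra.
  by rewrite ler_wpM2r //; lra.
apply: (@le_trans _ _ (- z / 2 * (2 * zeta))).
  by nra.
by apply: ler_wpM2r; have := expR_gt0 z; lra.
Qed.

(** The lower bound on z only uses e^z > 0; the upper one uses z^2 / 4 >= z - 1. *)
Lemma expR_gap_norm g z : expR z - 1 - z <= g -> `|z| <= g + 1.
Proof.
move=> h; rewrite ler_norml; apply/andP; split.
  by have := expR_gt0 z; lra.
have [h1|h1] := leP (-2) z; last by have := expR_sub1Bx_ge0 z; lra.
by have := expR_quad_small z h1; have := sqr_ge0 (z - 2); nra.
Qed.

(** Tangent at the larger point, whose slope is at most e^zeta. *)
Lemma expR_sub_norm zeta x y : x <= zeta -> y <= zeta ->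
  `|expR y - expR x| <= expR zeta * `|y - x|.
Proof.
wlog xy : x y / x <= y => [H|] hx hy.
  have [/H|/ltW/H] := leP x y; first exact.
  by rewrite distrC [`|y - x|]distrC; exact.
have h := expR_ge1Dx (x - y); rewrite expRB in h.
rewrite !ger0_norm ?subr_ge0 ?ler_expR //.
have y0 := expR_gt0 y.
have yz : expR y <= expR zeta by rewrite ler_expR.
rewrite ler_pdivlMr // in h; nra.
Qed.

(* [expR - id] is convex with derivative [expR - 1]. *)
Lemma expR_sub_id_norm zeta x y : 0 <= zeta -> `|x| <= zeta -> `|y| <= zeta ->
  `|expR y - expR x - (y - x)| <= expR zeta * (`|x| + `|y|) * `|y - x|.
Proof.
move=> z0 hx hy.
have bnd t : `|t| <= zeta -> `|expR t - 1| <= expR zeta * `|t|.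
  move=> ht; have := expR_sub_norm zeta 0 t z0 (le_trans (ler_norm t) ht).
  by rewrite expR0 subr0.
have tang (s t : R) : expR s * (t - s) <= expR t - expR s.
  have := expR_ge1Dx (t - s); rewrite expRB ler_pdivlMr ?expR_gt0 // => h.
  lra.
have up : expR y - expR x - (y - x) <= `|expR y - 1| * `|y - x|.
  rewrite -normrM; apply: le_trans (ler_norm _).
  by have := tang y x; lra.
have lo : - (expR y - expR x - (y - x)) <= `|expR x - 1| * `|y - x|.
  rewrite -normrM -normrN; apply: le_trans (ler_norm _).
  by have := tang x y; lra.
have bx := bnd x hx; have bY := bnd y hy.
have px : 0 <= expR zeta * `|x| by rewrite mulr_ge0 ?expR_ge0.
have py : 0 <= expR zeta * `|y| by rewrite mulr_ge0 ?expR_ge0.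
rewrite ler_norml lerNl mulrDr; apply/andP; split.
  by apply: (le_trans lo); rewrite ler_wpM2r //; lra.
by apply: (le_trans up); rewrite ler_wpM2r //; lra.
Qed.

End ExpInequalities.

(** * Rate of an alternating minimization *)

Section HalfStep.
Context {R : realType} {T : finType}.
Variables (rho : T -> R) (rho0 G : R).
Hypothesis rho_ge0 : forall t, 0 <= rho t.
Hypothesis rho0_gt0 : 0 < rho0.
Hypothesis rho_ge : forall t, 0 < rho t -> rho0 <= rho t.
Hypothesis G_ge0 : 0 <= G.

Lemma weighted_le_sum (f : T -> R) (c : R) t : (forall t, 0 <= f t) ->
  \sum_t rho t * f t <= c -> 0 < rho t -> f t <= c / rho0.
Proof.
move=> f0 hc ht; rewrite ler_pdivlMr //.
apply: le_trans hc; rewrite (bigD1 t) //=.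
apply: (@le_trans _ _ (rho t * f t)).
  by rewrite mulrC ler_wpM2r ?rho_ge.
by rewrite lerDl sumr_ge0 // => i _; rewrite mulr_ge0.
Qed.

Lemma weighted_sum_le (f : T -> R) (c : R) :
  (forall t, 0 < rho t -> f t <= c) -> \sum_t rho t * f t <= (\sum_t rho t) * c.
Proof.
move=> h; rewrite mulr_suml ler_sum // => t _.
have [->|rt] := eqVneq (rho t) 0; first by rewrite !mul0r.
have r0 : 0 < rho t by rewrite lt_neqAle eq_sym rt rho_ge0.
by rewrite ler_pM2l // h.
Qed.

(** [G / rho0 + 1] bounds |z| at positive weights, by [expR_gap_norm]; one more unit gives the bound
    2 required by [expR_quad]. *)
Let zeta := G / rho0 + 2.
(* [- 2 e d = e ^+ 2 + d ^+ 2 - z ^+ 2] for [z = e + d], and the weighted sum of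
   [z ^+ 2] is at most [2 * zeta * G]: the energy, which is at least 1, bounds
   the weighted sums of [e ^+ 2] and [d ^+ 2]. *)
Definition energy (e d : T -> R) :=
  2 * zeta * G + 1 - 2 * \sum_t rho t * (e t * d t).

Lemma energyC e d : energy e d = energy d e.
Proof. by congr (_ - 2 * _); apply: eq_bigr => t _; rewrite [e t * _]mulrC. Qed.

Let zeta2 : 2 <= zeta.
Proof. by rewrite lerDr divr_ge0 // ltW. Qed.

(** Each term e^z - 1 - z of positive weight is at most [G / rho0], which bounds z uniformly; on
    that range [expR_quad] turns the sum into a sum of squares. *)
Lemma gap_bound (z : T -> R) g : g <= G ->
  \sum_t rho t * (expR (z t) - 1 - z t) <= g ->
  [/\ 0 <= g,
      forall t, 0 < rho t -> `|z t| <= zeta,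
      \sum_t rho t * (z t ^+ 2) <= 2 * zeta * g
    & forall t, 0 < rho t -> z t ^+ 2 <= 2 * zeta * g / rho0 ].
Proof.
move=> gG h; have z2 := zeta2.
have pos t : 0 <= expR (z t) - 1 - z t by exact: expR_sub1Bx_ge0.
have g0 : 0 <= g.
  by apply: le_trans h; rewrite sumr_ge0 // => t _; rewrite mulr_ge0.
have nz t : 0 < rho t -> `|z t| <= zeta.
  move=> rt; have := weighted_le_sum _ _ t pos (le_trans h gG) rt.
  by move/expR_gap_norm; rewrite /zeta; lra.
have hs : \sum_t rho t * (z t ^+ 2) <= 2 * zeta * g.
  apply: (@le_trans _ _ (2 * zeta * \sum_t rho t * (expR (z t) - 1 - z t))).
    rewrite mulr_sumr ler_sum // => t _.
    have [->|rt] := eqVneq (rho t) 0; first by rewrite !mul0r mulr0.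
    have r0 : 0 < rho t by rewrite lt_neqAle eq_sym rt rho_ge0.
    rewrite [leRHS]mulrCA ler_pM2l // mulrC -ler_pdivrMr; last by (move: z2; lra).
    apply: expR_quad => //.
    by have := nz t r0; rewrite ler_norml => /andP[].
  by rewrite ler_pM2l //; lra.
split => // t rt; apply: (weighted_le_sum (fun s => z s ^+ 2)) hs rt.
by move=> t'; exact: sqr_ge0.
Qed.

Lemma sqr_le_sqrt (x c : R) : 0 <= c -> x ^+ 2 <= c -> `|x| <= Num.sqrt c.
Proof. by move=> c0 h; rewrite -sqrtr_sqr ler_sqrt. Qed.

(** One half step: e becomes e' while d is fixed. Once g <= G, the hypotheses bound KL(rstar | r),
    KL(rstar | r') and KL(r' | r) by g, g' and g - g', and then g' by <r' - r, d>. [A] and [B] are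
    chosen before the functions, so they serve for all iterations. *)
Lemma half_step : exists A B : R, [/\ 0 <= A, 0 <= B &
  forall (e d e' : T -> R) (g g' : R),
    let z t := e t + d t in let z' t := e' t + d t in
    g <= G ->
    \sum_t rho t * (expR (z t) - 1 - z t) <= g ->
    \sum_t rho t * (expR (z' t) - 1 - z' t) <= g' ->
    \sum_t rho t * (expR (z' t) * (z' t - z t) - expR (z' t) + expR (z t)) <= g - g' ->
    g' <= \sum_t rho t * ((expR (z' t) - expR (z t)) * d t) ->
  [/\ 0 <= g', g' <= g, 1 <= energy e d,
      energy e' d <= energy e d
        + A * (Num.sqrt (g - g') * Num.sqrt g * Num.sqrt (energy e d))
    & g' <= B * (Num.sqrt (g - g') * Num.sqrt (energy e d))]].
Proof.
have z2 := zeta2.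
pose P := \sum_t rho t.
have P0 : 0 <= P by rewrite sumr_ge0.
have ez := expR_gt0 zeta.
(* Pointwise bounds to come: |z' - z| <= ce sqrt(g - g'), |z| and |z'| <= cz sqrt g, |d| <= cd
   sqrt(energy). *)
pose ce := Num.sqrt (4 * zeta * expR zeta / rho0).
pose cz := Num.sqrt (2 * zeta / rho0).
pose cd := Num.sqrt (rho0^-1).
exists (2 * P * (expR zeta * (2 * cz) * ce * cd)), (P * (expR zeta * ce * cd)).
have ce0 : 0 <= ce by exact: sqrtr_ge0.
have cz0 : 0 <= cz by exact: sqrtr_ge0.
have cd0 : 0 <= cd by exact: sqrtr_ge0.
have i0 : 0 <= rho0^-1 by rewrite invr_ge0 ltW.
split; [by rewrite !mulr_ge0 // ltW|by rewrite !mulr_ge0 // ltW|].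
move=> e d e' g g' z z' gG h1 h1' h2 h3.
pose eta t := z' t - z t.
have eqeta t : expR (z' t) * (z' t - z t) - expR (z' t) + expR (z t)
    = expR (z' t) * (expR (- eta t) - 1 - (- eta t)).
  rewrite /eta opprB expRB; have := expR_gt0 (z' t) => h.
  by field; rewrite gt_eqF.
have gg' : 0 <= g - g'.
  apply: le_trans h2; rewrite sumr_ge0 // => t _; rewrite mulr_ge0 // eqeta.
  by rewrite mulr_ge0 ?expR_ge0 ?expR_sub1Bx_ge0.
have le_gg' : g' <= g by rewrite -subr_ge0.
have [g0 nz sz pz] := gap_bound _ _ gG h1.
have [g0' nz' sz' pz'] := gap_bound _ _ (le_trans le_gg' gG) h1'.
have p_eta t : 0 < rho t -> `|eta t| <= ce * Num.sqrt (g - g').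
  move=> rt; rewrite -sqrtrM; last by rewrite !mulr_ge0 // ?ltW //; lra.
  apply: sqr_le_sqrt.
    by rewrite !mulr_ge0 // ?ltW //; lra.
  have sum_eta : \sum_t rho t * eta t ^+ 2 <= 4 * zeta * expR zeta * (g - g').
    apply: le_trans (_ : 4 * zeta * expR zeta * _ <= _); last first.
      by rewrite ler_pM2l; [exact: h2|rewrite !mulr_gt0 //; lra].
    rewrite mulr_sumr ler_sum // => s _.
    have [->|rs] := eqVneq (rho s) 0; first by rewrite !mul0r mulr0.
    have r0 : 0 < rho s by rewrite lt_neqAle eq_sym rs rho_ge0.
    rewrite [leRHS]mulrCA ler_pM2l // eqeta.
    have := nz s r0; have := nz' s r0; rewrite !ler_norml => /andP[a1 a2] /andP[b1 b2].
    (* |eta| is at most 2 zeta, and e^(z') at least e^(-zeta): hence the factor 4 zeta e^zeta. *)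
    have := expR_quad (2 * zeta) (- eta s).
    rewrite sqrrN ler_pdivrMr; last by lra.
    move=> /(_ _ _) h.
    have {h}h : eta s ^+ 2 <= (expR (- eta s) - 1 - - eta s) * (2 * (2 * zeta)).
      by apply: h; [lra|rewrite /eta; lra].
    have h1z : 1 <= expR zeta * expR (z' s).
      by rewrite -expRD -{1}(expR0) ler_expR; lra.
    have h0 := expR_sub1Bx_ge0 (- eta s).
    apply: le_trans h _; set c := expR (- eta s) - 1 - - eta s in h0 *.
    have -> : 4 * zeta * expR zeta * (expR (z' s) * c) =
      (expR zeta * expR (z' s)) * (c * (2 * (2 * zeta))) by ring.
    by rewrite ler_peMl // mulr_ge0 //; lra.
  have := weighted_le_sum _ _ t (fun s => sqr_ge0 _) sum_eta rt.
  by rewrite -!mulrA [rho0^-1 * _]mulrC.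
have p_z t : 0 < rho t -> `|z t| <= cz * Num.sqrt g.
  move=> rt; rewrite -sqrtrM; last by rewrite mulr_ge0 //; lra.
  apply: sqr_le_sqrt; first by rewrite !mulr_ge0 //; lra.
  by have := pz t rt; rewrite mulrAC.
have p_z' t : 0 < rho t -> `|z' t| <= cz * Num.sqrt g.
  move=> rt; rewrite -sqrtrM; last by rewrite mulr_ge0 //; lra.
  apply: sqr_le_sqrt; first by rewrite !mulr_ge0 //; lra.
  apply: le_trans (pz' t rt) _; rewrite [leRHS]mulrAC ler_wpM2r //.
  by rewrite ler_pM2l //; lra.
have en : 2 * zeta * G + 1 - 2 * zeta * g + \sum_t rho t * (d t ^+ 2) <= energy e d.
  rewrite /energy.
  have -> : - (2 * \sum_t rho t * (e t * d t)) =
     \sum_t rho t * (e t ^+ 2) + \sum_t rho t * (d t ^+ 2) - \sum_t rho t * (z t ^+ 2).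
    rewrite mulr_sumr -big_split /= -sumrB -sumrN /=.
    by apply: eq_bigr => t _; rewrite /z; ring.
  have : 0 <= \sum_t rho t * (e t ^+ 2).
    by rewrite sumr_ge0 // => t _; rewrite mulr_ge0 // sqr_ge0.
  lra.
have zG : 2 * zeta * g <= 2 * zeta * G by rewrite ler_pM2l //; lra.
have d2 : 0 <= \sum_t rho t * (d t ^+ 2).
  by rewrite sumr_ge0 // => t _; rewrite mulr_ge0 // sqr_ge0.
have en1 : 1 <= energy e d by lra.
have p_d t : 0 < rho t -> `|d t| <= cd * Num.sqrt (energy e d).
  move=> rt; rewrite -sqrtrM //; apply: sqr_le_sqrt.
    by rewrite mulr_ge0 //; lra.
  rewrite mulrC; apply: (weighted_le_sum (fun s => d s ^+ 2)) rt.
    by move=> s; exact: sqr_ge0.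
  by move: en; lra.
split => //.
- have -> : energy e' d = energy e d - 2 * \sum_t rho t * (eta t * d t).
    rewrite /energy.
    have -> : \sum_t rho t * (e' t * d t) =
        \sum_t rho t * (e t * d t) + \sum_t rho t * (eta t * d t).
      by rewrite -big_split; apply: eq_bigr => t _; rewrite /eta /z /z' /=; ring.
    by ring.
  rewrite lerD2l.
  have -> : 2 * P * (expR zeta * (2 * cz) * ce * cd) *
    (Num.sqrt (g - g') * Num.sqrt g * Num.sqrt (energy e d)) =
   2 * (P * (expR zeta * (2 * cz) * ce * cd *
    (Num.sqrt (g - g') * Num.sqrt g * Num.sqrt (energy e d)))) by ring.
  rewrite -mulrN ler_pM2l //.
  (* As 0 <= g' <= <e^z' - e^z, d>, this pairing may be added to -<eta, d>. The first-order parts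
     cancel, and the remainder is controlled by [expR_sub_id_norm]. *)
  apply: (@le_trans _ _ (\sum_t rho t * ((expR (z' t) - expR (z t) - eta t) * d t))).
    have -> : \sum_t rho t * ((expR (z' t) - expR (z t) - eta t) * d t) =
      \sum_t rho t * ((expR (z' t) - expR (z t)) * d t) - \sum_t rho t * (eta t * d t).
      by rewrite -sumrB; apply: eq_bigr => t _; ring.
    lra.
  apply: weighted_sum_le => t rt; apply: le_trans (ler_norm _) _; rewrite normrM.
  have hb := expR_sub_id_norm zeta (z t) (z' t).
  apply: (@le_trans _ _ (expR zeta * (2 * (cz * Num.sqrt g)) * (ce * Num.sqrt (g - g'))
     * (cd * Num.sqrt (energy e d)))); last by rewrite le_eqVlt; apply/orP; left; apply/eqP; ring.
  apply: ler_pM => //; last exact: p_d.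
  apply: (le_trans (hb _ _ _)); [lra|exact: nz|exact: nz'|].
  apply: ler_pM => //; last exact: p_eta.
  rewrite ler_pM2l //; have := p_z t rt; have := p_z' t rt; lra.
- apply: (le_trans h3).
  rewrite -mulrA; apply: weighted_sum_le => t rt.
  apply: le_trans (ler_norm _) _; rewrite normrM.
  apply: (@le_trans _ _ (expR zeta * (ce * Num.sqrt (g - g'))
     * (cd * Num.sqrt (energy e d)))); last by rewrite le_eqVlt; apply/orP; left; apply/eqP; ring.
  apply: ler_pM => //; last exact: p_d.
  have := expR_sub_norm zeta (z t) (z' t).
  move=> h; apply: (le_trans (h _ _)).
  + exact: le_trans (ler_norm _) (nz t rt).
  + exact: le_trans (ler_norm _) (nz' t rt).
  by rewrite ler_pM2l // p_eta.
Qed.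

End HalfStep.

(** * From one-step inequalities to the rate 1/l *)

Section Rate.
Context {R : realType}.

(* With potential [M] and gap [g], a step multiplies [M] by at most
   [1 + C (sqrt g - sqrt g')]; these factors telescope. *)
Lemma step_potential (A B G M M' g g' : R) : 0 <= A -> 0 <= B ->
  0 <= g' -> g' <= g -> g <= G -> 1 <= M ->
  M' <= M + A * (Num.sqrt (g - g') * Num.sqrt g * Num.sqrt M) ->
  g' <= B * (Num.sqrt (g - g') * Num.sqrt M) ->
  M' * expR (2 * A * (B + Num.sqrt G) * Num.sqrt g')
    <= M * expR (2 * A * (B + Num.sqrt G) * Num.sqrt g).
Proof.
move=> A0 B0 g'0 g'g gG M1 hM hg.
set C := 2 * A * (B + Num.sqrt G).
set dl := Num.sqrt (g - g') in hM hg; set a := Num.sqrt g in hM *.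
set m := Num.sqrt M in hM hg; set a' := Num.sqrt g'.
have g0 : 0 <= g by apply: le_trans g'g.
have a0 : 0 <= a by exact: sqrtr_ge0.
have a'0 : 0 <= a' by exact: sqrtr_ge0.
have d0 : 0 <= dl by exact: sqrtr_ge0.
have a2 : a ^+ 2 = g by rewrite sqr_sqrtr.
have a'2 : a' ^+ 2 = g' by rewrite sqr_sqrtr.
have d2 : dl ^+ 2 = g - g' by rewrite sqr_sqrtr // subr_ge0.
have m2 : m ^+ 2 = M by rewrite sqr_sqrtr //; lra.
have m0 : 0 <= m by exact: sqrtr_ge0.
have m1 : 1 <= m by rewrite -sqrtr1 ler_sqrt //; lra.
have aa' : a' <= a by rewrite ler_sqrt.
set B' := B + Num.sqrt G in C *.
have dG : dl <= Num.sqrt G by rewrite ler_sqrt //; lra.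
(* Write g = g' + dl^2; the second summand is at most sqrt G * (dl * m), since dl <= sqrt G and 1 <=
   m. *)
have hB : a ^+ 2 <= B' * (dl * m).
  rewrite a2 /B' mulrDl -(subrK g' g) addrC; apply: lerD => //.
  rewrite -d2 expr2 -[leLHS]mulr1 -mulrA; apply: ler_pM => //; last first.
    by apply: ler_pM.
  by rewrite mulr1.
have hd : dl ^+ 2 <= 2 * a * (a - a').
  rewrite d2 -a2 -a'2; have := mulr_ge0 a0 a'0; nra.
(* Multiply [hd] by [hB] and divide by dl * a, the case dl * a = 0 being trivial. *)
have key : dl * a * m <= 2 * B' * ((a - a') * M).
  have [z|nz] := eqVneq (dl * a) 0.
    rewrite z mul0r !mulr_ge0 ?subr_ge0 //; last lra.
    by rewrite /B' addr_ge0 ?sqrtr_ge0.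
  have pos : 0 < dl * a by rewrite lt_neqAle eq_sym nz mulr_ge0.
  rewrite -(ler_pM2l pos).
  apply: (@le_trans _ _ ((2 * a * (a - a')) * (B' * (dl * m)) * m)).
    have -> : dl * a * (dl * a * m) = dl ^+ 2 * a ^+ 2 * m by ring.
    by rewrite ler_wpM2r //; apply: ler_pM; rewrite ?sqr_ge0.
  by rewrite -m2 le_eqVlt; apply/orP; left; apply/eqP; ring.
have hM' : M' <= M * (1 + C * (a - a')).
  apply: (le_trans hM); rewrite mulrDr mulr1 lerD2l.
  apply: (le_trans (ler_wpM2l A0 key)).
  by rewrite le_eqVlt; apply/orP; left; apply/eqP; rewrite /C; ring.
have -> : C * a = C * (a - a') + C * a' by ring.
rewrite expRD mulrA ler_wpM2r ?expR_ge0 //; apply: (le_trans hM').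
by rewrite ler_wpM2l ?expR_ge1Dx //; lra.
Qed.

(** Induction on l. If x = g (l + 1) exceeded C / (k + 1), with k = l + 1, the recursion would give
    x k <= D, hence C k < D (k + 1), whereas C >= 2 D and k >= 1. *)
Lemma harmonic_rate (D : R) (g : nat -> R) : 0 <= D -> (forall l, 0 <= g l) ->
  (forall l, g l.+1 ^+ 2 <= D * (g l - g l.+1)) ->
  exists C, forall l, g l <= C / l.+1%:R.
Proof.
move=> D0 g0 hg; pose C := g 0%N + 2 * D; exists C.
have C0 : 0 <= C by rewrite addr_ge0 ?mulr_ge0.
elim=> [|l IH]; first by rewrite divr1 /C; lra.
rewrite leNgt; apply/negP => h.
have p1 : 0 < l.+1%:R :> R by [].
have p2 : 0 < l.+2%:R :> R by [].
set x := g l.+1 in h hg *.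
have h1 : C < x * l.+2%:R by rewrite -ltr_pdivrMr.
have h2 : g l * l.+1%:R <= C by rewrite -ler_pdivlMr.
have e : l.+2%:R = l.+1%:R + 1 :> R by rewrite -natr1.
have hx := hg l; rewrite -/x in hx.
have x0 : 0 < x.
  by rewrite lt_neqAle eq_sym g0 andbT; apply: contraTneq h1 => ->; rewrite mul0r -leNgt.
set k : R := l.+1%:R in p1 h2 e *.
have k1 : 1 <= k by rewrite /k ler1n.
rewrite e in h1.
have : x ^+ 2 * k <= D * (C - x * k).
  apply: (@le_trans _ _ (D * (g l - x) * k)); first by rewrite ler_wpM2r // ltW.
  by rewrite -mulrA ler_wpM2l // mulrBl lerD2r.
have : D * (C - x * k) <= D * x by rewrite ler_wpM2l //; lra.
have hC : D * (k + 1) <= C * k by rewrite /C; have := g0 0%N; nra.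
move=> a1 a2; have xk : x * k <= D.
  by rewrite -(ler_pM2l x0) mulrA -expr2 [x * D]mulrC; exact: le_trans a2 a1.
have : C * k < D * (k + 1).
  apply: (@lt_le_trans _ _ (x * (k + 1) * k)); first by rewrite ltr_pM2r.
  by rewrite mulrAC ler_wpM2r //; lra.
lra.
Qed.

End Rate.

(** * The alternating scheme in abstract form *)

Section AlternatingRate.
Context {R : realType} {T : finType}.
Variables (rho : T -> R) (e d : nat -> T -> R) (alpha beta : nat -> R).
Hypothesis rho_ge0 : forall t, 0 <= rho t.

Let mean (f : T -> R) : R := \sum_t rho t * f t.

(** [alpha] and [beta] stand for the two conjugates minus their optimal values, divided by eps, and
    [rho] for the weights of rstar. [lbound] is weak duality; the slopes are subgradient
    inequalities of the conjugates, tested at the previous iterate and, for [slope_e0] and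
    [slope_d0], at the optimal pair. *)
Hypothesis lbound : forall l m, - mean (fun t => e l t + d m t) <= alpha l + beta m.
Hypothesis slope_e : forall l,
  mean (fun t => expR (e l.+1 t + d l t) * (e l.+1 t - e l t)) <= alpha l - alpha l.+1.
Hypothesis slope_e0 : forall l,
  mean (fun t => expR (e l.+1 t + d l t) * e l.+1 t) <= - alpha l.+1.
Hypothesis slope_d : forall l,
  mean (fun t => expR (e l.+1 t + d l.+1 t) * (d l.+1 t - d l t)) <= beta l - beta l.+1.
Hypothesis slope_d0 : forall l,
  mean (fun t => expR (e l t + d l t) * d l t) <= - beta l.

Let gap l m := alpha l + beta m + mean (fun t => expR (e l t + d m t) - 1).

Let meanD f g : mean (fun t => f t + g t) = mean f + mean g.
Proof. by rewrite /mean -big_split; apply: eq_bigr => t _ /=; rewrite mulrDr. Qed.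

Let meanN f : mean (fun t => - f t) = - mean f.
Proof. by rewrite /mean -sumrN; apply: eq_bigr => t _ /=; rewrite mulrN. Qed.

Let ler_mean (f g : T -> R) : (forall t, f t <= g t) -> mean f <= mean g.
Proof. by move=> h; apply: ler_sum => t _; rewrite ler_wpM2l. Qed.

Let eq_mean (f g : T -> R) : f =1 g -> mean f = mean g.
Proof. by move=> h; apply: eq_bigr => t _; rewrite h. Qed.

Let expR_slope (x : R) : expR x - 1 <= expR x * x.
Proof.
have := expR_ge1Dx (- x); rewrite expRN => /(ler_wpM2l (expR_ge0 x)).
by rewrite divff ?gt_eqF ?expR_gt0 //; lra.
Qed.

Let gap_lb l m : mean (fun t => expR (e l t + d m t) - 1 - (e l t + d m t)) <= gap l m.
Proof. by rewrite meanD meanN /gap [leLHS]addrC lerD2r; exact: lbound. Qed.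

Lemma alternating_rate :
  exists C, forall l, gap l l <= C / l.+1%:R.
Proof.
have gap_ge0 l m : 0 <= gap l m.
  apply: le_trans (gap_lb l m); apply: sumr_ge0 => t _.
  by rewrite mulr_ge0 ?expR_sub1Bx_ge0.
have [rho0 rho0_gt0 rho_ge] := finite_pos_lbound _ rho.
pose G := gap 0%N 0%N.
have [A [B [A0 B0 step]]] := half_step rho rho0 G rho_ge0 rho0_gt0 rho_ge (gap_ge0 _ _).
pose En l m := energy rho rho0 G (e l) (d m).
have step1 l : gap l l <= G -> [/\ 0 <= gap l.+1 l, gap l.+1 l <= gap l l, 1 <= En l l,
      En l.+1 l <= En l l + A * (Num.sqrt (gap l l - gap l.+1 l) * Num.sqrt (gap l l)
        * Num.sqrt (En l l))
    & gap l.+1 l <= B * (Num.sqrt (gap l l - gap l.+1 l) * Num.sqrt (En l l))].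
  move=> gG; apply: step => //=; try exact: gap_lb.
  - have -> : gap l l - gap l.+1 l = alpha l - alpha l.+1 +
       mean (fun t => expR (e l t + d l t) - expR (e l.+1 t + d l t)).
      rewrite /gap !meanD !meanN; ring.
    apply: le_trans (lerD (slope_e l) (lexx _)); rewrite -meanD.
    by apply: ler_mean => t; rewrite le_eqVlt; apply/orP; left; apply/eqP; ring.
  (* With e^x - 1 <= x e^x, the new gap is at most -<r', e'> - <r, d> + <r', e' + d> = <r' - r,
     d>. *)
  - have h1 := slope_e0 l; have h2 := slope_d0 l.
    rewrite /gap; set S := mean _.
    have : S <= mean (fun t => expR (e l.+1 t + d l t) * (e l.+1 t + d l t)).
      by apply: ler_mean => t; exact: expR_slope.
    rewrite (_ : mean (fun t => _ * (_ + _)) =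
       mean (fun t => expR (e l.+1 t + d l t) * e l.+1 t) +
       mean (fun t => expR (e l.+1 t + d l t) * d l t)); last first.
      by rewrite -meanD; apply: eq_mean => t; rewrite mulrDr.
    have -> : \sum_t rho t * ((expR (e l.+1 t + d l t) - expR (e l t + d l t)) * d l t) =
       mean (fun t => expR (e l.+1 t + d l t) * d l t) -
       mean (fun t => expR (e l t + d l t) * d l t).
      by rewrite -meanN -meanD; apply: eq_mean => t; ring.
    lra.
have step2 l : gap l.+1 l <= G -> [/\ 0 <= gap l.+1 l.+1, gap l.+1 l.+1 <= gap l.+1 l,
      1 <= En l.+1 l,
      En l.+1 l.+1 <= En l.+1 l + A * (Num.sqrt (gap l.+1 l - gap l.+1 l.+1)
        * Num.sqrt (gap l.+1 l) * Num.sqrt (En l.+1 l))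
    & gap l.+1 l.+1 <= B * (Num.sqrt (gap l.+1 l - gap l.+1 l.+1) * Num.sqrt (En l.+1 l))].
  (* The symmetric half step: [energyC] and [swap] exchange the roles of e and d. *)
  move=> gG; rewrite /En ![energy _ _ _ (e _) _]energyC.
  have swap m (f : R -> R) : mean (fun t => f (d m t + e l.+1 t)) =
      mean (fun t => f (e l.+1 t + d m t)) by apply: eq_mean => t; rewrite addrC.
  apply: step => //=.
  - by have := gap_lb l.+1 l; rewrite -(swap l (fun z => expR z - 1 - z)).
  - by have := gap_lb l.+1 l.+1; rewrite -(swap l.+1 (fun z => expR z - 1 - z)).
  - have -> : gap l.+1 l - gap l.+1 l.+1 = beta l - beta l.+1 +
       mean (fun t => expR (e l.+1 t + d l t) - expR (e l.+1 t + d l.+1 t)).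
      rewrite /gap !meanD !meanN; ring.
    apply: le_trans (lerD (slope_d l) (lexx _)); rewrite -meanD.
    apply: ler_mean => t; rewrite ![d _ t + _]addrC.
    by rewrite le_eqVlt; apply/orP; left; apply/eqP; ring.
  - have h1 := slope_e0 l; have h2 := slope_d0 l.+1.
    rewrite /gap; set S := mean _.
    have : S <= mean (fun t => expR (e l.+1 t + d l.+1 t) * (e l.+1 t + d l.+1 t)).
      by apply: ler_mean => t; exact: expR_slope.
    rewrite (_ : mean (fun t => _ * (_ + _)) =
       mean (fun t => expR (e l.+1 t + d l.+1 t) * e l.+1 t) +
       mean (fun t => expR (e l.+1 t + d l.+1 t) * d l.+1 t)); last first.
      by rewrite -meanD; apply: eq_mean => t; rewrite mulrDr.
    have -> : \sum_t rho t * ((expR (d l.+1 t + e l.+1 t) - expR (d l t + e l.+1 t)) * e l.+1 t) =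
       mean (fun t => expR (e l.+1 t + d l.+1 t) * e l.+1 t) -
       mean (fun t => expR (e l.+1 t + d l t) * e l.+1 t).
      by rewrite -meanN -meanD; apply: eq_mean => t; rewrite ![d _ t + _]addrC; ring.
    lra.
have gapG l : gap l l <= G.
  elim: l => [//|l IH]; have [_ h1 _ _ _] := step1 l IH.
  by have [_ h2 _ _ _] := step2 l (le_trans h1 IH); lra.
have gapG' l : gap l.+1 l <= G by have [_ h1 _ _ _] := step1 l (gapG l); exact: le_trans (gapG l).
pose C := 2 * A * (B + Num.sqrt G).
pose pot l m := En l m * expR (C * Num.sqrt (gap l m)).
have C0 : 0 <= C by rewrite !mulr_ge0 // addr_ge0 ?sqrtr_ge0.
have pot1 l : pot l.+1 l <= pot l l.
  have [g0 gg M1 hM hg] := step1 l (gapG l).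
  exact: step_potential A0 B0 g0 gg (gapG l) M1 hM hg.
have pot2 l : pot l.+1 l.+1 <= pot l.+1 l.
  have [g0 gg M1 hM hg] := step2 l (gapG' l).
  exact: step_potential A0 B0 g0 gg (gapG' l) M1 hM hg.
have potB l : pot l l <= pot 0%N 0%N.
  by elim: l => [//|l IH]; apply: le_trans (pot2 l) (le_trans (pot1 l) IH).
have EnB l : En l.+1 l <= pot 0%N 0%N.
  have [_ _ M1 _ _] := step2 l (gapG' l).
  apply: le_trans (le_trans (pot1 l) (potB l)); rewrite /pot -[leLHS]mulr1.
  rewrite ler_wpM2l //; first lra.
  by rewrite -expR0 ler_expR mulr_ge0 ?sqrtr_ge0.
pose D := B ^+ 2 * pot 0%N 0%N.
have pot0 : 0 <= pot 0%N 0%N by have [_ _ M1 _ _] := step2 0%N (gapG' 0%N); have := EnB 0%N; lra.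
apply: (harmonic_rate D (fun l => gap l l)) => [|//|l].
  by rewrite mulr_ge0 // sqr_ge0.
(* The second half step alone yields the recursion for [harmonic_rate]; the first one only has to
   keep the gap from increasing. *)
have [g0 gg M1 _ hg] := step2 l (gapG' l).
have [_ gg1 _ _ _] := step1 l (gapG l).
have : gap l.+1 l.+1 ^+ 2 <=
   (B * (Num.sqrt (gap l.+1 l - gap l.+1 l.+1) * Num.sqrt (En l.+1 l))) ^+ 2.
  by rewrite ler_sqr ?nnegrE // !mulr_ge0 ?sqrtr_ge0.
have En0 : 0 <= En l.+1 l by exact: le_trans M1.
rewrite !exprMn (sqr_sqrtr En0) sqr_sqrtr; last by rewrite subr_ge0.
move=> h; apply: (le_trans h); rewrite /D -mulrA ler_wpM2l ?sqr_ge0 //.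
by rewrite [leLHS]mulrC; apply: ler_pM; [exact: En0|rewrite subr_ge0|exact: EnB|rewrite lerB].
Qed.

End AlternatingRate.
(** * Approximate Lagrange multipliers by penalization *)

Section Compactness.
Context {R : realType}.

Lemma ptws_cvg (U : Type) (V : topologicalType) (F : set_system (U -> V))
    (f : U -> V) : Filter F ->
  (forall t, (fun g : U -> V => g t) @ F --> f t) -> F --> (f : {ptws U -> V}).
Proof.
move=> FF h; apply/cvg_sup => t Q; rewrite nbhsE /= => -[A [[B oB <-] fB] AQ].
apply: filterS AQ _; apply: h.
by apply: open_nbhs_nbhs; split.
Qed.

(** Lower semicontinuity in terms of coordinate boxes, which spares the later arguments any topology
    on functions. *)
Definition box_lsc (I : finType) (f : (I -> R) -> \bar R) :=
  forall x a, (a%:E < f x)%E -> exists2 delta : R, 0 < delta &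
    forall y, (forall i, `|y i - x i| < delta) -> (a%:E < f y)%E.

(** The filter generated by the boxes around a point converges to it coordinate by coordinate, so
    every neighbourhood contains a box. *)
Lemma box_lsc_ptws (n : nat) (T : finType) (F : ('I_n -> T -> R) -> \bar R) :
  @lower_semicontinuous {ptws 'I_n -> {ptws T -> R}} R F ->
  box_lsc ('I_n * T)%type (fun x => F (fun k t => x (k, t))).
Proof.
move=> lF x a /lF [V + Va].
pose s : {ptws 'I_n -> {ptws T -> R}} := fun k t => x (k, t).
pose box (d : R) := [set y : 'I_n -> T -> R | forall k t, `|y k t - s k t| < d].
pose B := filter_from [set d : R | 0 < d] box.
have FB : Filter B.
  apply: filter_from_filter; first by exists 1 => /=.
  move=> d1 d2 /= p1 p2; exists (Num.min d1 d2) => /=; first by rewrite lt_min p1.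
  by move=> y yB; split=> k t; have := yB k t; rewrite lt_min => /andP[].
have cB : B --> s.
  apply: (@ptws_cvg _ {ptws T -> R} B s) => k.
  apply: (@ptws_cvg T R _ (s k)) => t; move=> Q /nbhs_ballP [e /= e0 eQ].
  by exists e => // y /(_ k t) yb; apply: eQ; rewrite /ball /= distrC.
move=> /cB [d /= d0 dV]; exists d => // y yd.
by apply: Va (dV (fun k t => y (k, t)) _) => k t; exact: yd.
Qed.

(** Compactness of the cube [-M, M]^I by Tychonoff; a cluster point stands in for the limit of a
    subsequence. *)
Lemma bounded_cluster (I : finType) (x : nat -> I -> R) (M : R) :
  (forall m i, `|x m i| <= M) ->
  exists l : I -> R, forall (d : R) (N : nat), 0 < d ->
    exists2 m, (N <= m)%N & forall i, `|x m i - l i| < d.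
Proof.
move=> xM.
have cpt : @compact (prod_topology (fun _ : I => R))
    [set f | forall i, f i \in `[- M, M]].
  exact: (tychonoff (A := fun=> [set` `[- M, M]])) (fun=> @segment_compact _ _ _).
have [|l [_ cl]] := cpt (x @ \oo) _.
  by exists 0%N => // m _ i; rewrite /= in_itv /= -ler_norml.
exists l => d N d0.
have bx : nbhs (l : {ptws I -> R}) [set y | forall i, `|y i - l i| < d].
  apply: (@filter_forall _ I (fun i => [set y : I -> R | `|y i - l i| < d])
    _ (nbhs_filter (l : {ptws I -> R}))) => i.
  have [B Bl hB] : exists2 B : set R, nbhs (l i) B & forall t, B t -> `|t - l i| < d.
    exists (ball (l i) d); first exact: nbhsx_ballx.
    by move=> t; rewrite /ball /= distrC.
  have := @proj_continuous I (fun=> R) i l B Bl.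
  rewrite nbhs_filterE => h; apply: (@filterS _ _ (nbhs_filter (l : {ptws I -> R}))) h => y By.
  exact: hB.
have tl : (x @ \oo) [set x m | m in [set m | (N <= m)%N]].
  by exists N => // m /= Nm; exists m.
by have [_ [[m Nm <-] h]] := cl _ _ tl bx; exists m.
Qed.

(** Both [f] and [c] depend on N in order to cover minimizing sequences (fixed function, decreasing
    bounds) as well as growing penalties (fixed bound). *)
Lemma lsc_cluster (I : finType) (f : nat -> (I -> R) -> \bar R)
    (x : nat -> I -> R) (c : nat -> R) (M : R) :
  (forall N, box_lsc I (f N)) -> (forall m i, `|x m i| <= M) ->
  (forall N m, (N <= m)%N -> (f N (x m) <= (c N)%:E)%E) ->
  exists l, forall N, (f N l <= (c N)%:E)%E.
Proof.
move=> lf /bounded_cluster [l hl] hc; exists l => N.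
rewrite leNgt; apply/negP => /(lf N) [d d0 h].
have [m Nm /h] := hl d N d0.
by rewrite ltNge hc.
Qed.

End Compactness.

(** * Penalized minimization under linear constraints *)

Section LagrangeMultiplier.
Context {R : realType} {I J : finType}.
Variables (Phi : (I -> R) -> \bar R) (L : (I -> R) -> J -> R).
Variables (kappa m alpha : R).

Let sqn (y : J -> R) := \sum_j y j ^+ 2.

Hypothesis Phi_lsc : box_lsc I Phi.
Hypothesis Phi_convex : forall x y (t cx cy : R), 0 < t < 1 ->
  (Phi x <= cx%:E)%E -> (Phi y <= cy%:E)%E ->
  (Phi (fun i => t * x i + (1 - t) * y i)%R <= (t * cx + (1 - t) * cy)%:E)%E.
Hypothesis Phi_finite : exists x, (Phi x < +oo)%E.
Hypothesis kappa_gt0 : 0 < kappa.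
Hypothesis L_linear : forall t x y j,
  L (fun i => t * x i + (1 - t) * y i) j = t * L x j + (1 - t) * L y j.
Hypothesis L_lip : forall x y (d : R), (forall i, `|y i - x i| <= d) ->
  forall j, `|L y j - L x j| <= kappa * d.
Hypothesis Phi_lbound : forall x, (m%:E <= Phi x + (sqn (L x))%:E)%E.
(** Sublevel sets are bounded only up to the choice of a representative, since coordinates at points
    of zero weight are free. *)
Hypothesis Phi_bounded : forall c : R, exists M : R, forall x,
  (Phi x + (sqn (L x))%:E <= c%:E)%E -> exists x', [/\ forall i, `|x' i| <= M,
    Phi x' = Phi x & forall j, L x' j = L x j].
Hypothesis alpha_le : forall x, (forall j, L x j = 0) -> (alpha%:E <= Phi x)%E.

Let pen (lam : R) x := (Phi x + (lam * sqn (L x))%:E)%E.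

Let sqn_ge0 y : 0 <= sqn y.
Proof. by rewrite sumr_ge0 // => j _; rewrite sqr_ge0. Qed.

Let sqn_tangent (y z : J -> R) :
  sqn y + 2 * \sum_j y j * (z j - y j) <= sqn z.
Proof.
rewrite mulr_sumr -big_split /= ler_sum // => j _.
have := sqr_ge0 (z j - y j); lra.
Qed.

Let Phi_gtNy x : (-oo < Phi x)%E.
Proof. by have := Phi_lbound x; case: (Phi x) => // r _; exact: ltNyr. Qed.

Let pen_le (lam mu : R) x : lam <= mu -> (pen lam x <= pen mu x)%E.
Proof. by move=> h; rewrite leeD2l // lee_fin ler_wpM2r. Qed.

(** The penalty lies above its tangent at L x, which varies little on a small box because L is
    Lipschitz. *)
Let pen_lsc (lam : R) : 0 <= lam -> box_lsc I (pen lam).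
Proof.
move=> lam0 x a; rewrite /pen -lteBlDr // => h.
set b := lam * sqn (L x) in h.
have [a' aa' a'Phi] : exists2 a', a - b < a' & (a'%:E < Phi x)%E.
  move: h; rewrite -EFinB; case: (Phi x) => [r||//].
    rewrite lte_fin => h; exists ((a - b + r) / 2); rewrite ?lte_fin; lra.
  by move=> _; exists (a - b + 1); [lra|rewrite ltry].
have [d1 d10 hd1] := Phi_lsc x a' a'Phi.
pose S := \sum_j `|L x j|.
have S0 : 0 <= S by rewrite sumr_ge0.
(* On a box of radius e / D the tangent drops by at most e, the slack gained from [a']. *)
pose D := 1 + 2 * lam * kappa * S.
have D0 : 0 < D by rewrite ltr_pwDl // !mulr_ge0 // ltW.
pose e := a' - (a - b).
have e0 : 0 < e by rewrite subr_gt0.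
exists (Num.min d1 (e / D)); first by rewrite lt_min d10 divr_gt0.
move=> y hy.
have hy1 : (a'%:E < Phi y)%E.
  by apply: hd1 => i; have := hy i; rewrite lt_min => /andP[].
have hy2 j : `|L y j - L x j| <= kappa * (e / D).
  by apply: L_lip => i; have := hy i; rewrite lt_min => /andP[_ /ltW].
have hs : b - e <= lam * sqn (L y).
  have h1 := ler_wpM2l lam0 (sqn_tangent (L x) (L y)).
  apply: le_trans h1; rewrite mulrDr lerD2l lerNl.
  apply: (@le_trans _ _ (lam * (2 * (S * (kappa * (e / D)))))).
    rewrite -!mulrN ler_wpM2l // ler_pM2l // -sumrN mulr_suml ler_sum // => j _.
    rewrite -mulrN; apply: le_trans (ler_norm _) _; rewrite normrM normrN.
    by rewrite ler_wpM2l.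
  have -> : lam * (2 * (S * (kappa * (e / D)))) = (2 * lam * kappa * S) / D * e by ring.
  by rewrite ler_piMl ?(ltW e0) // ler_pdivrMr // mul1r /D lerDr.
have -> : a%:E = (a'%:E + (b - e)%:E)%E by rewrite -EFinD /e; congr EFin; ring.
by rewrite lte_leD // lee_fin.
Qed.

(** Direct method. From 1 <= lam, [pen lam] dominates [Phi + sqn \o L], whose bounds are in
    [Phi_lbound] and [Phi_bounded]. *)
Let pen_argmin (lam : R) : 1 <= lam ->
  exists x, forall y, (pen lam x <= pen lam y)%E.
Proof.
move=> lam1; pose S := range (pen lam).
have lam0 : 0 <= lam by exact: le_trans lam1.
have mS : (m%:E <= ereal_inf S)%E.
  apply: le_ereal_inf_tmp => _ [x _ <-]; apply: le_trans (Phi_lbound x) _.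
  by rewrite -[sqn _]mul1r; exact: pen_le.
have [x0 x0y] := Phi_finite.
have Sy : (ereal_inf S < +oo)%E.
  apply: le_lt_trans (_ : (pen lam x0 < +oo)%E); last by rewrite lte_add_pinfty ?ltry.
  by apply: ereal_inf_lbound; exists x0.
have [i Si] : exists i : R, ereal_inf S = i%:E.
  by move: mS Sy; case: (ereal_inf S) => // r _ _; exists r.
have [M hM] := Phi_bounded (i + 1).
have /choice [x hx] k : exists x, (forall i, `|x i| <= M) /\
    (pen lam x <= (i + k.+1%:R^-1)%:E)%E.
  have k0 : 0 < k.+1%:R^-1 :> R by rewrite invr_gt0.
  have [|_ [y _ <-] hy] := @ereal_inf_lt _ S (i + k.+1%:R^-1)%:E.
    by rewrite Si lte_fin ltrDl.
  have [|x [xM Px Lx]] := hM y.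
    apply: (@le_trans _ _ (pen lam y)); first by rewrite -[sqn _]mul1r; exact: pen_le.
    by apply: (le_trans (ltW hy)); rewrite lee_fin lerD2l invf_le1 // ler1n.
  exists x; split => //; rewrite /pen Px (_ : sqn (L x) = sqn (L y)); first exact: ltW.
  by apply: eq_bigr => j _; rewrite Lx.
have [l hl] : exists l, forall N : nat, (pen lam l <= (i + N.+1%:R^-1)%:E)%E.
  apply: (@lsc_cluster _ _ (fun=> pen lam) x (fun N => i + N.+1%:R^-1) M).
  - by move=> _; exact: pen_lsc.
  - by move=> k; exact: (hx k).1.
  - move=> N k Nk; apply: le_trans (hx k).2 _.
    by rewrite lee_fin lerD2l lef_pV2 ?posrE // ler_nat.
exists l => y; apply: (@le_trans _ _ i%:E); last first.
  by rewrite -Si; apply: ereal_inf_lbound; exists y.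
apply/lee_addgt0Pr => e e0.
have [N _ hN] := near_infty_natSinv_lt (PosNum e0).
apply: (le_trans (hl N)); rewrite -EFinD lee_fin lerD2l ltW //.
by apply: hN => /=.
Qed.

(** First-order condition along the segment from x to y: the penalty is quadratic there, so the
    error is lam * Q * t, and t tends to 0. *)
Let pen_subgradient (lam : R) x : 0 <= lam ->
    (forall y, (pen lam x <= pen lam y)%E) ->
  exists f : R, Phi x = f%:E /\ forall y,
    ((f - 2 * lam * \sum_j L x j * (L y j - L x j))%:E <= Phi y)%E.
Proof.
move=> lam0 hx.
have [x0 x0y] := Phi_finite.
have [f Pf] : exists f, Phi x = f%:E.
  have := Phi_gtNy x; have := hx x0; rewrite /pen; move: x0y.
  case: (Phi x) => [r|//|//]; first by exists r.
  by case: (Phi x0).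
exists f; split => // y.
case E : (Phi y) => [c||]; last 2 first.
- by rewrite leey.
- by have := Phi_gtNy y; rewrite E.
rewrite lee_fin.
pose S := \sum_j L x j * (L y j - L x j).
pose Q := \sum_j (L y j - L x j) ^+ 2.
have Q0 : 0 <= Q by rewrite sumr_ge0 // => j _; rewrite sqr_ge0.
have ht (t : R) : 0 < t < 1 -> f - 2 * lam * S - c <= lam * Q * t.
  move=> t01; have /andP [t0 t1] := t01.
  have Pt : (Phi (fun i => t * y i + (1 - t) * x i)%R <= (t * c + (1 - t) * f)%:E)%E.
    by apply: Phi_convex; rewrite ?Pf ?E.
  have := hx (fun i => t * y i + (1 - t) * x i).
  rewrite /pen Pf => h.
  have {}h := le_trans h (leeD2r _ Pt); rewrite -!EFinD lee_fin in h.
  have sq : sqn (L (fun i => t * y i + (1 - t) * x i)) =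
      sqn (L x) + 2 * t * S + t ^+ 2 * Q.
    rewrite /sqn /S /Q !mulr_sumr -!big_split /=.
    by apply: eq_bigr => j _; rewrite L_linear; ring.
  rewrite sq in h.
  rewrite -(ler_pM2l t0); lra.
rewrite -subr_le0 leNgt; apply/negP; rewrite -/S.
set X := f - 2 * lam * S - c in ht * => h.
have := small_le0 X (lam * Q) 1 ltr01 (mulr_ge0 lam0 Q0) ht.
by rewrite leNgt h.
Qed.

(* The multiplier is the slope of the penalty [lam * sqn (L x)] at a minimizer
   of [Phi + lam * sqn \o L], for a large [lam]. *)
Theorem approx_multiplier (delta : R) : 0 < delta ->
  exists w : J -> R, forall x,
    ((alpha - delta - \sum_j w j * L x j)%:E <= Phi x)%E.
Proof.
move=> d0; apply: contrapT => /forallNP hw.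
(* If the minimum of the penalized problem were above alpha - delta for some N, the slope of the
   penalty would be a suitable w. *)
have /choice [x hx] (N : nat) : exists x, (pen N.+1%:R x <= (alpha - delta)%:E)%E.
  have N1 : 1 <= N.+1%:R :> R by rewrite ler1n.
  have N0 : 0 <= N.+1%:R :> R by exact: le_trans N1.
  have [x hx] := pen_argmin N.+1%:R N1; exists x.
  have [f [Pf sub]] := pen_subgradient N.+1%:R x N0 hx.
  rewrite leNgt; apply/negP => h.
  apply: (hw (fun j => 2 * N.+1%:R * L x j)) => y; apply: le_trans (sub y).
  rewrite lee_fin; move: h; rewrite /pen Pf -EFinD lte_fin => h.
  have -> : \sum_j L x j * (L y j - L x j) = \sum_j L x j * L y j - sqn (L x).
    by rewrite -sumrB; apply: eq_bigr => j _; ring.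
  have -> : \sum_j 2 * N.+1%:R * L x j * L y j = 2 * N.+1%:R * \sum_j L x j * L y j.
    by rewrite mulr_sumr; apply: eq_bigr => j _; ring.
  have := mulr_ge0 N0 (sqn_ge0 (L x)); set A := \sum_j _; set B := sqn _ in h *.
  lra.
have [M hM] := Phi_bounded (alpha - delta).
have /choice [y hy] (N : nat) : exists y, (forall i, `|y i| <= M) /\
    (pen N.+1%:R y <= (alpha - delta)%:E)%E.
  have [|y [yM Py Ly]] := hM (x N).
    apply: le_trans (hx N); rewrite -[sqn _]mul1r; apply: pen_le.
    by rewrite ler1n.
  exists y; split => //; rewrite /pen Py (_ : sqn (L y) = sqn (L (x N))) //.
    exact: hx.
  by apply: eq_bigr => j _; rewrite Ly.
have [l hl] : exists l, forall N : nat, (pen N.+1%:R l <= (alpha - delta)%:E)%E.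
  apply: (@lsc_cluster _ _ (fun N => pen N.+1%:R) y (fun=> alpha - delta) M).
  - by move=> N; apply: pen_lsc.
  - by move=> k; exact: (hy k).1.
  - move=> N k Nk; apply: le_trans (hy k).2; apply: pen_le.
    by rewrite ler_nat.
have [f Pf] : exists f, Phi l = f%:E.
  have := Phi_gtNy l; have := hl 0%N; rewrite /pen.
  by case: (Phi l) => [r|//|//]; exists r.
have hN (N : nat) : N.+1%:R * sqn (L l) <= alpha - delta - f.
  by have := hl N; rewrite /pen Pf -EFinD lee_fin; lra.
(* (N + 1) sqn (L l) stays bounded, so the cluster point satisfies the constraints, and Phi l <=
   alpha - delta contradicts [alpha_le]. *)
have s0 : sqn (L l) = 0.
  apply/eqP; rewrite eq_le sqn_ge0 andbT leNgt; apply/negP => s0.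
  pose D := 1 + `|alpha - delta - f|.
  have D0 : 0 < D by rewrite ltr_pwDl.
  have [N _ h] := near_infty_natSinv_lt (PosNum (divr_gt0 s0 D0)).
  have := h N (leqnn N); rewrite /= ltr_pdivlMr // mulrC ltr_pdivrMr //.
  rewrite mulrC /D => h1.
  have := hN N; have := ler_norm (alpha - delta - f); lra.
have Ll j : L l j = 0.
  apply/eqP; rewrite -sqrf_eq0; apply/eqP; move/eqP: s0.
  rewrite psumr_eq0 => [/allP /(_ j)|k _]; last exact: sqr_ge0.
  by rewrite mem_index_enum => /(_ isT) /eqP.
have := alpha_le l Ll; have := hl 0%N.
by rewrite /pen Pf s0 mulr0 adde0 !lee_fin; lra.
Qed.

End LagrangeMultiplier.
(** * Relative entropy and proximal points *)

Section ScalarKL.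
Context {R : realType}.
Implicit Types r s w t : R.

Definition klf r s : R := ln (r / s) * r - r + s.

Lemma klf0 s : klf 0 s = s.
Proof. by rewrite /klf mulr0 subrr add0r. Qed.

(** Fenchel-Young for the scalar entropy: with l = ln (r / s), it is r (1 + w - l) <= r e^(w - l) =
    s e^w. *)
Lemma klf_young r s w : 0 <= r -> 0 < s -> w * r - s * (expR w - 1) <= klf r s.
Proof.
move=> r0 s0; have [->|nz] := eqVneq r 0.
  by rewrite klf0; have := mulr_ge0 (ltW s0) (expR_ge0 w); lra.
have rp : 0 < r by rewrite lt_neqAle eq_sym nz.
have er : r / s * s = r by rewrite divfK // gt_eqF.
rewrite /klf; set l := ln (r / s).
have el : expR l = r / s by rewrite lnK // posrE divr_gt0.
have : r * (1 + (w - l)) <= r * expR (w - l) by rewrite ler_pM2l // expR_ge1Dx.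
have -> : r * expR (w - l) = s * expR w.
  by rewrite expRB el -{1}er; field; rewrite !gt_eqF.
lra.
Qed.

(** For r > 0 equality holds at w = ln (r / s). For r = 0 the supremum is only approached as w tends
    to -oo, whence [eta]. *)
Lemma klf_young_approx r s (eta : R) : 0 <= r -> 0 < s -> 0 < eta ->
  exists w, klf r s - eta <= w * r - s * (expR w - 1).
Proof.
move=> r0 s0 e0; have [->|nz] := eqVneq r 0.
  exists (ln (eta / s)); rewrite klf0 lnK ?posrE ?divr_gt0 // mulr0 mulrBr mulr1.
  by rewrite mulrCA divff ?gt_eqF //; lra.
have rp : 0 < r by rewrite lt_neqAle eq_sym nz.
exists (ln (r / s)); rewrite /klf lnK ?posrE ?divr_gt0 // mulrBr mulrCA.
by rewrite divff ?gt_eqF //; lra.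
Qed.

(** In r, the integrand is a supremum of affine functions; one of them is within e of it at the
    intermediate point. *)
Lemma klf_convex r1 r2 s t : 0 <= r1 -> 0 <= r2 -> 0 < s -> 0 < t < 1 ->
  klf (t * r1 + (1 - t) * r2) s <= t * klf r1 s + (1 - t) * klf r2 s.
Proof.
move=> r10 r20 s0 /andP[t0 t1]; apply/ler_addgt0Pr => e e0.
have [|w hw] := klf_young_approx (t * r1 + (1 - t) * r2) s e _ s0 e0.
  by rewrite addr_ge0 // mulr_ge0 //; lra.
have t0' : 0 <= t by lra.
have t1' : 0 <= 1 - t by lra.
have := ler_wpM2l t0' (klf_young r1 s w r10 s0).
have := ler_wpM2l t1' (klf_young r2 s w r20 s0).
lra.
Qed.

Lemma klf_ge0 r s : 0 <= r -> 0 < s -> 0 <= klf r s.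
Proof.
by move=> r0 s0; have := klf_young r s 0 r0 s0; rewrite expR0 subrr mulr0 mul0r subr0.
Qed.

Lemma klf_eq0 r s : 0 <= r -> 0 < s -> klf r s = 0 -> r = s.
Proof.
move=> r0 s0; have [->|nz] := eqVneq r 0; first by rewrite klf0.
have rp : 0 < r by rewrite lt_neqAle eq_sym nz.
have q0 : 0 < r / s by rewrite divr_gt0.
rewrite /klf; set l := ln (r / s) => h.
have el : expR l = r / s by rewrite lnK.
have [l0|l0] := eqVneq l 0.
  by move: el; rewrite l0 expR0 => /esym /(divr1_eq); exact.
have : 1 + - l < expR (- l) by rewrite expR_gt1Dx // oppr_eq0.
rewrite expRN el invf_div ltr_pdivlMr //; lra.
Qed.

(** From ln x <= x - 1 at x = r / s. *)
Lemma klf_le_sqr r s : 0 <= r -> 0 < s -> klf r s <= (r - s) ^+ 2 / s.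
Proof.
move=> r0 s0; have [->|nz] := eqVneq r 0.
  by rewrite klf0 sub0r sqrrN expr2 mulfK ?gt_eqF.
have rp : 0 < r by rewrite lt_neqAle eq_sym nz.
have q0 : 0 < r / s by rewrite divr_gt0.
have : ln (r / s) <= r / s - 1.
  have -> : ln (r / s) = ln (1 + (r / s - 1)) by congr ln; ring.
  by apply: le_ln1Dx; lra.
move=> /(ler_wpM2r r0) h; rewrite /klf.
have -> : (r - s) ^+ 2 / s = (r / s - 1) * r - r + s by field; rewrite gt_eqF.
by lra.
Qed.

(** Three-point identity of the Bregman divergence of the entropy. *)
Lemma klf_shift r s z : 0 <= r -> 0 < s -> 0 < z ->
  klf r z - klf s z = ln (s / z) * (r - s) + klf r s.
Proof.
move=> r0 s0 z0; have [->|nz] := eqVneq r 0; first by rewrite !klf0 /klf; ring.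
have rp : 0 < r by rewrite lt_neqAle eq_sym nz.
by rewrite /klf !ln_div ?posrE //; ring.
Qed.

End ScalarKL.

(** * Conjugates, subgradients and the optimality condition of a prox *)

Section Conjugates.
(* MathComp-Analysis has its own [ae_eq], which shadows the one of Defs. *)
Local Notation ae_eq := Defs.ae_eq.
Context {R : realType} {n : nat} {T : finType}.
Variable p : T -> R.
Hypothesis p_ge0 : forall t, 0 <= p t.
Implicit Types (r s w z : 'I_n -> T -> R) (F : ('I_n -> T -> R) -> \bar R).

Lemma weight_cases t : p t = 0 \/ 0 < p t.
Proof.
by have [|nz] := eqVneq (p t) 0; [left|right; rewrite lt_neqAle eq_sym nz p_ge0].
Qed.

Lemma eq_weighted_sum (f g : 'I_n -> T -> R) :
  (forall k t, 0 < p t -> f k t = g k t) ->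
  \sum_k \sum_t p t * f k t = \sum_k \sum_t p t * g k t.
Proof.
move=> h; apply: eq_bigr => k _; apply: eq_bigr => t _.
by have [->|/h ->] := weight_cases t; rewrite ?mul0r.
Qed.

Lemma pairing_ae r r' s s' : ae_eq p r r' -> ae_eq p s s' ->
  pairing p r s = pairing p r' s'.
Proof. by move=> hr hs; apply: eq_weighted_sum => k t pt; rewrite hr // hs. Qed.

Lemma pairingDl w w' s :
  pairing p (fun k t => w k t + w' k t) s = pairing p w s + pairing p w' s.
Proof.
rewrite /pairing -big_split; apply: eq_bigr => k _; rewrite -big_split.
by apply: eq_bigr => t _ /=; ring.
Qed.

Lemma pairingZl (c : R) w s :
  pairing p (fun k t => c * w k t) s = c * pairing p w s.
Proof.
rewrite /pairing mulr_sumr; apply: eq_bigr => k _; rewrite mulr_sumr.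
by apply: eq_bigr => t _ /=; ring.
Qed.

Lemma pairingNl w s : pairing p (fun k t => - w k t) s = - pairing p w s.
Proof.
rewrite -mulN1r -pairingZl; apply: eq_bigr => k _; apply: eq_bigr => t _; ring.
Qed.

Lemma KL_fin r s : (forall k t, 0 < p t -> 0 <= r k t) -> ae_pos p s ->
  KL p r s = (\sum_k \sum_t p t * klf (r k t) (s k t))%:E.
Proof.
move=> r0 s0; rewrite /KL; case: asboolP => // -[] k t pt.
split; [exact: r0|exact/ltW/s0|move=> e].
by have := s0 k t pt; rewrite e ltxx.
Qed.

Lemma KL_lty r s : (KL p r s < +oo)%E -> forall k t, 0 < p t -> 0 <= r k t.
Proof.
by rewrite /KL; case: asboolP => [h _ k t pt|_]; [case: (h k t pt)|rewrite ltxx].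
Qed.

Lemma KL_ae r r' s s' : ae_eq p r r' -> ae_eq p s s' -> KL p r s = KL p r' s'.
Proof.
move=> hr hs; rewrite /KL (_ : asbool _ = `[< forall k t, 0 < p t ->
  [/\ 0 <= r' k t, 0 <= s' k t & s' k t = 0 -> r' k t = 0] >]); last first.
  by apply: asbool_equiv_eq; split=> h k t pt; have := h k t pt; rewrite hr // hs.
case: ifP => // _; congr EFin; apply: eq_weighted_sum => k t pt.
by rewrite hr // hs.
Qed.

Lemma KL_ge0 r s : ae_pos p s -> (0 <= KL p r s)%E.
Proof.
move=> s0; case E : (KL p r s) => [x||]; last 2 first.
- by rewrite leey.
- by move: E; rewrite /KL; case: ifP.
have /KL_lty r0 : (KL p r s < +oo)%E by rewrite E ltry.
move: E; rewrite KL_fin // => -[<-]; rewrite lee_fin.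
apply: sumr_ge0 => k _; apply: sumr_ge0 => t _.
have [->|pt] := weight_cases t; first by rewrite mul0r.
by rewrite mulr_ge0 // klf_ge0 ?r0 ?s0.
Qed.

Lemma conjugate_ge F w s (c : R) : F s = c%:E ->
  ((pairing p w s - c)%:E <= conjugate p F w)%E.
Proof. by move=> Fs; apply: ereal_sup_ubound; exists s => //; rewrite Fs EFinB. Qed.

Lemma conjugate_gtNy F w : Defs.proper F -> (-oo < conjugate p F w)%E.
Proof.
move=> [FN [s Fs]]; case E : (F s) => [c||].
- by apply: lt_le_trans (conjugate_ge _ w _ _ E); rewrite ltNyr.
- by rewrite E in Fs.
- by have := FN s; rewrite E.
Qed.

(** [c] records that F is finite at s, so that later inequalities are between reals. *)
Definition subgradient F w s (c : R) := F s = c%:E /\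
  forall s', ((c + pairing p w s' - pairing p w s)%:E <= F s')%E.

Lemma subgradient_conjugate F w s (c : R) : subgradient F w s c ->
  conjugate p F w = (pairing p w s - c)%:E.
Proof.
move=> [Fs sub]; apply/eqP; rewrite eq_le conjugate_ge // andbT.
apply: ge_ereal_sup => _ [s' _ <-]; have := sub s'.
case: (F s') => [c'||]; rewrite ?leNye //.
- by rewrite -EFinB !lee_fin; lra.
Qed.

Lemma subgradient_ae F w w' s s' (c : R) : ae_invariant p F ->
  ae_eq p w w' -> ae_eq p s s' -> subgradient F w s c -> subgradient F w' s' c.
Proof.
move=> Fae hw hs [Fs sub]; split; first by rewrite -(Fae _ _ hs).
move=> s''; have := sub s''.
by rewrite (pairing_ae w w' s'' s'') // (pairing_ae w w' s s').
Qed.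

(* [KL (s + h | z) = KL (s | z) + <ln (s / z), h> + O(|h| ^ 2)], so [s] being a
   minimizer forces the first-order condition on [F]. *)
Lemma prox_subgradient F (eps : R) z s : convex_functional p F -> 0 < eps ->
  ae_pos p z -> ae_pos p s -> is_prox p F eps z s ->
  exists c, subgradient F (fun k t => - (eps * ln (s k t / z k t))) s c.
Proof.
move=> [_ [FN _] Fc _] e0 z0 s0 [slt smin].
have sge0 k t (pt : 0 < p t) : 0 <= s k t by exact/ltW/s0.
rewrite KL_fin // -EFinM in slt.
have [c Fs] : exists c, F s = c%:E.
  by move: slt (FN s); case: (F s) => // c _ _; exists c.
exists c; split => // s'.
case Fs' : (F s') => [c'||]; rewrite ?leey //; last by have := FN s'; rewrite Fs'.
pose S (f : 'I_n -> T -> R) := \sum_k \sum_t p t * f k t.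
pose h k t := s' k t - s k t.
(* For t < t0, s + t h remains nonnegative at positive weights; the value 1 at null points is a
   placeholder. *)
have [t0 t0_gt0 ht0] := finite_pos_lbound ('I_n * T)%type (fun i =>
  if 0 < p i.2 then s i.1 i.2 / (1 + `|h i.1 i.2|) else 1).
pose q1 := S (fun k t => ln (s k t / z k t) * h k t).
pose q2 := S (fun k t => h k t ^+ 2 / s k t).
have q20 : 0 <= q2.
  apply: sumr_ge0 => k _; apply: sumr_ge0 => t _.
  have [->|pt] := weight_cases t; first by rewrite mul0r.
  by rewrite mulr_ge0 // divr_ge0 ?sqr_ge0 ?sge0.
have key t : 0 < t < Num.min 1 t0 -> (c - eps * q1) - c' <= eps * q2 * t.
  rewrite lt_min => /and3P[tp t1 tt0].
  pose st : 'I_n -> T -> R := fun k x => t * s' k x + (1 - t) * s k x.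
  have stE k x : st k x = s k x + t * h k x by rewrite /st /h; ring.
  have st0 k x : 0 < p x -> 0 <= st k x.
    move=> px; have := ht0 (k, x); rewrite /= px.
    have D0 : 0 < 1 + `|h k x| by rewrite ltr_pwDl.
    move=> /(_ (divr_gt0 (s0 k x px) D0)); rewrite ler_pdivlMr // => hx.
    have h1 : t * (1 + `|h k x|) <= s k x.
      by apply: le_trans hx; rewrite ler_wpM2r // ltW.
    have h2 : t * - h k x <= t * `|h k x|.
      by rewrite ler_pM2l // -normrN; exact: ler_norm.
    rewrite stE; lra.
  have := smin st; rewrite Fs !KL_fin // -!EFinM -EFinD => hs.
  have t01 : 0 < t < 1 by rewrite tp.
  have := Fc s' s t t01; rewrite Fs Fs' -!EFinM -EFinD => hc.
  have {}hs := le_trans hs (leeD2r _ hc); rewrite -EFinD lee_fin in hs.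
  have hk : S (fun k x => klf (st k x) (z k x)) - S (fun k x => klf (s k x) (z k x))
      <= t * q1 + t ^+ 2 * q2.
    rewrite /S /q1 /q2 !mulr_sumr -sumrB -big_split /=; apply: ler_sum => k _.
    rewrite !mulr_sumr -sumrB -big_split /=; apply: ler_sum => x _.
    have [->|px] := weight_cases x; first by rewrite !mul0r !mulr0 subr0 addr0.
    rewrite -mulrBr klf_shift ?st0 ?s0 ?z0 //.
    have := klf_le_sqr (st k x) (s k x) (st0 k x px) (s0 k x px).
    move=> /(ler_wpM2l (p_ge0 x)).
    have -> : st k x - s k x = t * h k x by rewrite stE; ring.
    by rewrite exprMn; lra.
  have {}hk := ler_wpM2l (ltW e0) hk.
  rewrite -(ler_pM2l tp); move: hs hk; rewrite /S; lra.
have t0' : 0 < Num.min 1 t0 by rewrite lt_min ltr01.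
have := small_le0 _ _ _ t0' (mulr_ge0 (ltW e0) q20) key.
rewrite lee_fin -[X in _ -> is_true (X <= _)]addrA.
have -> : pairing p (fun k t => - (eps * ln (s k t / z k t))) s' -
   pairing p (fun k t => - (eps * ln (s k t / z k t))) s = - (eps * q1).
  rewrite /pairing /q1 /S -sumrB mulr_sumr -sumrN; apply: eq_bigr => k _.
  rewrite -sumrB mulr_sumr -sumrN; apply: eq_bigr => t _.
  by rewrite /h; ring.
lra.
Qed.

End Conjugates.

(** * Lower semicontinuity on coordinate boxes *)

Section LowerSemicontinuity.
Context {R : realType}.

Lemma box_lsc_comp (I I' : finType) (g : I' -> I) (f : (I' -> R) -> \bar R) :
  box_lsc I' f -> box_lsc I (fun x => f (fun i => x (g i))).
Proof.
move=> lf x a /lf [d d0 h]; exists d => // y yd.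
by apply: h => i; exact: yd.
Qed.

Lemma box_lscD (I : finType) (f g : (I -> R) -> \bar R) :
  (forall x, -oo < f x)%E -> (forall x, -oo < g x)%E ->
  box_lsc I f -> box_lsc I g -> box_lsc I (fun x => (f x + g x)%E).
Proof.
move=> fN gN lf lg x a afg.
have [b bf ag] : exists2 b, (b%:E < f x)%E & ((a - b)%:E < g x)%E.
  move: afg (fN x) (gN x); case: (f x) => [u||//]; case: (g x) => [v||//].
  - rewrite -EFinD lte_fin => h _ _; exists (u - (u + v - a) / 2); rewrite lte_fin; lra.
  - by move=> _ _ _; exists (u - 1); rewrite ?lte_fin ?ltry //; lra.
  - move=> _ _ _; exists (a - v + 1); first by rewrite ltry.
    by rewrite lte_fin; lra.
  - by move=> _ _ _; exists 0; rewrite ltry.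
have [d1 d10 h1] := lf x b bf.
have [d2 d20 h2] := lg x (a - b) ag.
exists (Num.min d1 d2); first by rewrite lt_min d10.
move=> y hy.
have y1 : (b%:E < f y)%E by apply: h1 => i; have := hy i; rewrite lt_min => /andP[].
have y2 : ((a - b)%:E < g y)%E.
  by apply: h2 => i; have := hy i; rewrite lt_min => /andP[].
have -> : a%:E = (b%:E + (a - b)%:E)%E by rewrite -EFinD addrC subrK.
exact: lteD.
Qed.

(** If x is negative at a point of positive weight, KL is +oo on a whole box. Otherwise affine
    minorants from Fenchel-Young, almost tight at x, bound KL from below nearby. *)
Lemma box_lsc_KL (n : nat) (T : finType) (p : T -> R) (eps : R)
    (s : 'I_n -> T -> R) :
  (forall t, 0 <= p t) -> 0 < eps -> ae_pos p s ->
  box_lsc ('I_n * T)%type (fun x => (eps%:E * KL p (fun k t => x (k, t)) s)%E).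
Proof.
move=> p0 e0 s0 x a.
have [xpos|] := pselect (forall k t, 0 < p t -> 0 <= x (k, t)); last first.
  move/existsNP => [k /existsNP [t /not_implyP [pt /negP]]]; rewrite -ltNge => xn _.
  exists (- x (k, t)); first lra.
  move=> y hy; case E : (KL p _ s) => [v||]; last 2 first.
  - by rewrite gt0_muley ?ltry // lte_fin.
  - by have := KL_ge0 _ p0 (fun k t => y (k, t)) s s0; rewrite E.
  have /KL_lty /(_ k t pt) : (KL p (fun k t => y (k, t)) s < +oo)%E by rewrite E ltry.
  by move=> yk; exfalso; move: yk; clear E; have := hy (k, t); rewrite ltr_norml => /andP[]; lra.
rewrite KL_fin // -EFinM lte_fin.
set S := \sum_k _ => aS.
pose P := \sum_(k < n) \sum_t p t.
have P0 : 0 <= P by apply: sumr_ge0 => k _; exact: sumr_ge0.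
(* The total loss is eta * P from the minorants and d * W <= eta from the box: together at most half
   of S - a / eps. *)
pose eta := (S - a / eps) / (2 * (1 + P)).
have D0 : 0 < 2 * (1 + P) by lra.
have eta0 : 0 < eta by rewrite divr_gt0 // subr_gt0 ltr_pdivrMr // mulrC.
have /choice [w hw] (j : 'I_n * T) : exists w, 0 < p j.2 ->
    klf (x j) (s j.1 j.2) - eta <= w * x j - s j.1 j.2 * (expR w - 1).
  have [h|h] := boolP (0 < p j.2); last by exists 0.
  have xj : 0 <= x j by have := xpos j.1 j.2 h; case: (j).
  by have [w hw] := klf_young_approx (x j) _ eta xj (s0 j.1 j.2 h) eta0; exists w.
pose W := \sum_k \sum_t p t * `|w (k, t)|.
have W0 : 0 <= W by do 2 (apply: sumr_ge0 => ? _); rewrite mulr_ge0.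
pose d := eta / (1 + W).
have d0 : 0 < d by rewrite divr_gt0 // ltr_pwDl.
exists d => // y hy; case E : (KL p _ s) => [v||]; last 2 first.
- by rewrite gt0_muley ?ltry // lte_fin.
- by have := KL_ge0 _ p0 (fun k t => y (k, t)) s s0; rewrite E.
have /KL_lty ypos : (KL p (fun k t => y (k, t)) s < +oo)%E by rewrite E ltry.
move: E; rewrite KL_fin // => -[<-]; rewrite -EFinM lte_fin.
set S' := \sum_k _.
have h : S - (eta * P + d * W) <= S'.
  rewrite /S /P /W !mulr_sumr -big_split -sumrB; apply: ler_sum => k _ /=.
  rewrite !mulr_sumr -big_split -sumrB; apply: ler_sum => t _ /=.
  have [->|pt] := weight_cases _ p0 t; first by rewrite !mul0r !mulr0 addr0 subr0.
  have := hw (k, t) pt; rewrite /= => h1.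
  have h2 := klf_young (y (k, t)) (s k t) (w (k, t)) (ypos k t pt) (s0 k t pt).
  have h3 : w (k, t) * (x (k, t) - y (k, t)) <= `|w (k, t)| * d.
    apply: le_trans (ler_norm _) _; rewrite normrM ler_wpM2l // distrC.
    exact/ltW/hy.
  have : p t * (klf (x (k, t)) (s k t) - eta - `|w (k, t)| * d) <=
         p t * klf (y (k, t)) (s k t) by rewrite ler_pM2l //; lra.
  by lra.
have hdW : d * W <= eta.
  by rewrite /d mulrAC ler_pdivrMr ?ltr_pwDl // ler_pM2l //; lra.
have he : eta * (2 * (1 + P)) = S - a / eps by rewrite divfK // gt_eqF.
have : a / eps < S' by have := mulr_ge0 (ltW eta0) P0; lra.
by rewrite ltr_pdivrMr // mulrC.
Qed.

End LowerSemicontinuity.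

(** * Duality *)

Section Marginals.
Context {R : realType} {n : nat} {X Y : finType}.
Variables (p : X -> R) (q : Y -> R).

Lemma sum_prod_weights (f : 'I_n -> X * Y -> R) :
  \sum_k \sum_z prod_weights p q z * f k z =
  \sum_k \sum_x \sum_y p x * q y * f k (x, y).
Proof.
by apply: eq_bigr => k _; rewrite pair_bigA; apply: eq_bigr => -[].
Qed.

Lemma pairing_margX (u : 'I_n -> X -> R) (r : 'I_n -> X * Y -> R) :
  pairing p u (margX q r) = pairing (prod_weights p q) (fun k z => u k z.1) r.
Proof.
rewrite /pairing sum_prod_weights; apply: eq_bigr => k _; apply: eq_bigr => x _ /=.
by rewrite /margX !mulr_sumr; apply: eq_bigr => y _; ring.
Qed.

Lemma pairing_margY (v : 'I_n -> Y -> R) (r : 'I_n -> X * Y -> R) :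
  pairing q v (margY p r) = pairing (prod_weights p q) (fun k z => v k z.2) r.
Proof.
rewrite /pairing sum_prod_weights; apply: eq_bigr => k _ /=.
rewrite exchange_big /=; apply: eq_bigr => y _.
by rewrite /margY !mulr_sumr; apply: eq_bigr => x _; ring.
Qed.

End Marginals.

(** * Gibbs couplings and weak duality *)

Section Duality.
Context {R : realType} {n : nat} {X Y : finType}.
Variables (p : X -> R) (q : Y -> R).
Variables (F1 : ('I_n -> X -> R) -> \bar R) (F2 : ('I_n -> Y -> R) -> \bar R).
Variables (K : 'I_n -> X * Y -> R) (eps : R).
Hypotheses (eps_gt0 : 0 < eps) (hp : prob_weights p) (hq : prob_weights q).
Hypotheses (hF1 : convex_functional p F1) (hF2 : convex_functional q F2).
Hypothesis K_gt0 : ae_pos (prod_weights p q) K.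
Local Notation pi := (prod_weights p q).
Local Notation ae_eq := Defs.ae_eq.

Lemma prod_weights_ge0 z : 0 <= pi z.
Proof. by rewrite mulr_ge0 ?hp.1 ?hq.1. Qed.

Definition osum (u : 'I_n -> X -> R) (v : 'I_n -> Y -> R) :
  'I_n -> X * Y -> R := fun k z => u k z.1 + v k z.2.

Definition gibbs u v : 'I_n -> X * Y -> R :=
  fun k z => K k z * expR (osum u v k z / eps).

Lemma gibbs_gt0 u v : ae_pos pi (gibbs u v).
Proof. by move=> k z pz; rewrite mulr_gt0 ?expR_gt0 ?K_gt0. Qed.

Lemma klf_mulr_expR (r s w : R) : 0 <= r -> 0 < s ->
  klf r (s * expR w) = klf r s - w * r + s * (expR w - 1).
Proof.
move=> r0 s0; have [->|nz] := eqVneq r 0; first by rewrite !klf0; ring.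
have rp : 0 < r by rewrite lt_neqAle eq_sym nz.
by rewrite /klf !ln_div ?posrE ?mulr_gt0 ?expR_gt0 // lnM ?posrE ?expR_gt0 // expRK; ring.
Qed.

(** The defect in Fenchel-Young for the entropy, as an exact identity: it is the divergence to the
    Gibbs coupling. *)
Lemma KL_gibbs u v r : (forall k z, 0 < pi z -> 0 <= r k z) ->
  eps * (\sum_k \sum_z pi z * klf (r k z) (gibbs u v k z)) =
  eps * (\sum_k \sum_z pi z * klf (r k z) (K k z))
  - (pairing p u (margX q r) + pairing q v (margY p r))
  + eps * pairing pi (fun k z => expR (osum u v k z / eps) - 1) K.
Proof.
move=> r0; rewrite (pairing_margX p) (pairing_margY p q) -pairingDl /pairing.
rewrite !mulr_sumr -sumrB -big_split /=; apply: eq_bigr => k _.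
rewrite !mulr_sumr -sumrB -big_split /=; apply: eq_bigr => z _.
have [->|pz] := weight_cases _ prod_weights_ge0 z; first by rewrite !mul0r; ring.
rewrite klf_mulr_expR ?K_gt0 ?r0 // /osum; field.
by rewrite gt_eqF.
Qed.

Lemma neg_dual_lbound u v r (c1 c2 : R) :
  F1 (margX q r) = c1%:E -> F2 (margY p r) = c2%:E ->
  (forall k z, 0 < pi z -> 0 <= r k z) ->
  ((eps * (\sum_k \sum_z pi z * klf (r k z) (gibbs u v k z))
    - (c1 + c2 + eps * \sum_k \sum_z pi z * klf (r k z) (K k z)))%:E
   <= neg_dual p q F1 F2 K eps u v)%E.
Proof.
move=> E1 E2 r0; rewrite KL_gibbs //.
have h1 := conjugate_ge p _ (fun k x => - u k x) _ _ E1.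
have h2 := conjugate_ge q _ (fun k x => - v k x) _ _ E2.
rewrite /neg_dual; apply: le_trans (leeD2r _ (leeD h1 h2)).
rewrite -!EFinD lee_fin !pairingNl /osum; lra.
Qed.

Lemma primal_fin r : (primal p q F1 F2 K eps r < +oo)%E -> exists c1 c2 : R,
  [/\ F1 (margX q r) = c1%:E, F2 (margY p r) = c2%:E,
      forall k z, 0 < pi z -> 0 <= r k z
    & primal p q F1 F2 K eps r =
      (c1 + c2 + eps * \sum_k \sum_z pi z * klf (r k z) (K k z))%:E].
Proof.
case: hF1 hF2 => _ [N1 _] _ _ [_ [N2 _] _ _].
rewrite /primal; move: (N1 (margX q r)) (N2 (margY p r)).
case E1 : (F1 _) => [c1||//] _; case E2 : (F2 _) => [c2||//] _; last 3 first.
- case E : (KL _ _ _) => [x||]; rewrite ?gt0_muley ?lte_fin //.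
  by have := KL_ge0 _ prod_weights_ge0 r K K_gt0; rewrite E.
- case E : (KL _ _ _) => [x||]; rewrite ?gt0_muley ?lte_fin //.
  by have := KL_ge0 _ prod_weights_ge0 r K K_gt0; rewrite E.
- case E : (KL _ _ _) => [x||]; rewrite ?gt0_muley ?lte_fin //.
  by have := KL_ge0 _ prod_weights_ge0 r K K_gt0; rewrite E.
move=> h; exists c1, c2.
have r0 : forall k z, 0 < pi z -> 0 <= r k z.
  apply: (KL_lty pi r K); move: h; case: (KL _ _ _) => // [x _|]; first exact: ltry.
  by rewrite gt0_muley ?lte_fin.
by split => //; rewrite KL_fin // -EFinM -!EFinD.
Qed.

(** The supremum over s comes first, at fixed t. A point where F2 is finite shows that this supremum
    is a real, which can then change sides. *)
Lemma conjugate_sum_le (D : R) w1 w2 :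
  (forall s t (c1 c2 : R), F1 s = c1%:E -> F2 t = c2%:E ->
    pairing p w1 s - c1 + (pairing q w2 t - c2) <= D) ->
  (conjugate p F1 w1 + conjugate q F2 w2 <= D%:E)%E.
Proof.
move=> h; case: hF1 hF2 => _ pr1 _ _ [_ pr2 _ _].
have fin (c : \bar R) : (-oo < c)%E -> c != +oo%E -> exists r : R, c = r%:E.
  by case: c => // r _ _; exists r.
have [t0 [d0 E0]] : exists t0 d0, F2 t0 = d0%:E.
  have [N2 [t0 t0y]] := pr2; have [||d0 E0] := fin (F2 t0).
  - by rewrite ltNye N2.
  - by rewrite -ltey.
  - by exists t0, d0.
have le1 t (d : R) : F2 t = d%:E ->
    (conjugate p F1 w1 <= (D - (pairing q w2 t - d))%:E)%E.
  move=> Et; apply: ge_ereal_sup => _ [s _ <-].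
  case E : (F1 s) => [c||]; rewrite ?leNye //.
  - by rewrite -EFinB lee_fin; have := h s t c d E Et; lra.
  - by case: pr1 => N1 _; have := N1 s; rewrite E.
have [phi Ephi] : exists phi : R, conjugate p F1 w1 = phi%:E.
  apply: fin; first exact: conjugate_gtNy.
  by rewrite -ltey; apply: le_lt_trans (le1 _ _ E0) _; rewrite ltry.
have : (conjugate q F2 w2 <= (D - phi)%:E)%E.
  apply: ge_ereal_sup => _ [t _ <-].
  case E : (F2 t) => [d||]; rewrite ?leNye //.
  - have := le1 t d E; rewrite Ephi -EFinB !lee_fin; lra.
  - by case: pr2 => N2 _; have := N2 t; rewrite E.
by rewrite Ephi => /(leeD2l phi%:E); rewrite -EFinD [(phi + _)%R]addrC subrK.
Qed.

(** [KL_gibbs] at the Gibbs coupling itself, where the divergence vanishes: the equality case. *)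
Lemma pairing_gibbs u v :
  pairing p u (margX q (gibbs u v)) + pairing q v (margY p (gibbs u v))
  - eps * (\sum_k \sum_z pi z * klf (gibbs u v k z) (K k z)) =
  eps * pairing pi (fun k z => expR (osum u v k z / eps) - 1) K.
Proof.
have g0 k z : 0 < pi z -> 0 <= gibbs u v k z by move=> pz; exact/ltW/gibbs_gt0.
have := KL_gibbs u v _ g0.
rewrite (eq_weighted_sum _ prod_weights_ge0 _ (fun k z => 0)); last first.
  move=> k z pz; rewrite /klf divff ?gt_eqF ?gibbs_gt0 // ln1 mul0r add0r addNr //.
rewrite [X in eps * X = _]big1; last by move=> k _; rewrite big1 // => z _; rewrite mulr0.
lra.
Qed.

End Duality.

(** * Lipschitz bounds for weighted averages *)

Section Averages.
Context {R : realType}.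

Lemma prob_weights_le1 (T : finType) (m : T -> R) t : prob_weights m -> m t <= 1.
Proof.
by move=> [m0 <-]; rewrite (bigD1 t) //= lerDl sumr_ge0.
Qed.

Lemma norm_average_le (T : finType) (m f g : T -> R) d : prob_weights m ->
  (forall t, `|f t - g t| <= d) -> `|\sum_t m t * f t - \sum_t m t * g t| <= d.
Proof.
move=> [m0 m1] h; rewrite -sumrB; apply: le_trans (ler_norm_sum _ _ _) _.
rewrite -[leRHS]mul1r -m1 mulr_suml; apply: ler_sum => t _.
by rewrite -mulrBr normrM ger0_norm // ler_wpM2l.
Qed.

Lemma scaled_diff_lip (m a b a' b' d : R) : 0 <= m -> m <= 1 ->
  `|a - b| <= d -> `|a' - b'| <= d -> `|m * (a - a') - m * (b - b')| <= 2 * d.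
Proof.
move=> m0 m1 hab hab'; rewrite -mulrBr normrM ger0_norm //.
have h2 : `|a - a' - (b - b')| <= 2 * d.
  have -> : a - a' - (b - b') = (a - b) - (a' - b') by ring.
  by apply: le_trans (ler_normB _ _) _; lra.
by apply: le_trans h2; rewrite ler_piMl.
Qed.

End Averages.

(** * Strong duality by penalizing the marginal constraints *)

Section StrongDuality.
Context {R : realType} {n : nat} {X Y : finType}.
Variables (p : X -> R) (q : Y -> R).
Variables (F1 : ('I_n -> X -> R) -> \bar R) (F2 : ('I_n -> Y -> R) -> \bar R).
Variables (K : 'I_n -> X * Y -> R) (eps : R).
Hypotheses (eps_gt0 : 0 < eps) (hp : prob_weights p) (hq : prob_weights q).
Hypotheses (hF1 : convex_functional p F1) (hF2 : convex_functional q F2).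
Hypothesis K_gt0 : ae_pos (prod_weights p q) K.
Variables (u1 : 'I_n -> X -> R) (v1 : 'I_n -> Y -> R) (g1 g2 P : R).
Hypothesis F1_minorant : forall s, ((g1 - pairing p u1 s)%:E <= F1 s)%E.
Hypothesis F2_minorant : forall t, ((g2 - pairing q v1 t)%:E <= F2 t)%E.
Hypothesis P_le : forall r, (P%:E <= primal p q F1 F2 K eps r)%E.
Hypothesis primal_finite : exists r, (primal p q F1 F2 K eps r < +oo)%E.
Local Notation pi := (prod_weights p q).
Local Notation I := ('I_n * X + 'I_n * Y + 'I_n * (X * Y))%type.
Local Notation J := ('I_n * X + 'I_n * Y)%type.

Let sx (x : I -> R) : 'I_n -> X -> R := fun k t => x (inl (inl (k, t))).
Let sy (x : I -> R) : 'I_n -> Y -> R := fun k t => x (inl (inr (k, t))).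
Let sr (x : I -> R) : 'I_n -> X * Y -> R := fun k z => x (inr (k, z)).

(** A vector x stacks s, t and r. The residuals carry the weights: null points impose no constraint,
    and multipliers act through pairings. *)
Let L (x : I -> R) (j : J) : R := match j with
  | inl j => p j.2 * (sx x j.1 j.2 - margX q (sr x) j.1 j.2)
  | inr j => q j.2 * (sy x j.1 j.2 - margY p (sr x) j.1 j.2) end.

Let Phi (x : I -> R) : \bar R :=
  (F1 (sx x) + F2 (sy x) + eps%:E * KL pi (sr x) K)%E.

Let p0 : forall t, 0 <= p t := hp.1.
Let q0 : forall t, 0 <= q t := hq.1.
Let pi0 : forall z, 0 <= pi z := prod_weights_ge0 _ _ hp hq.

Let F1_gtNy s : (-oo < F1 s)%E.
Proof. by apply: lt_le_trans (F1_minorant s); rewrite ltNyr. Qed.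

Let F2_gtNy s : (-oo < F2 s)%E.
Proof. by apply: lt_le_trans (F2_minorant s); rewrite ltNyr. Qed.

Let epsKL_gtNy r : (-oo < eps%:E * KL pi r K)%E.
Proof.
apply: (@lt_le_trans _ _ 0%E); first exact: ltNyr.
by rewrite mule_ge0 ?lee_fin ?(ltW eps_gt0) ?KL_ge0.
Qed.

Lemma sum_sumpair (f : J -> R) :
  \sum_j f j = \sum_k \sum_x f (inl (k, x)) + \sum_k \sum_y f (inr (k, y)).
Proof.
rewrite big_sumType /= !pair_bigA.
by congr (_ + _); apply: eq_bigr => -[].
Qed.

Let sum_L (w : J -> R) x : \sum_j w j * L x j =
  pairing p (fun k t => w (inl (k, t))) (sx x)
  - pairing p (fun k t => w (inl (k, t))) (margX q (sr x))
  + (pairing q (fun k t => w (inr (k, t))) (sy x)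
     - pairing q (fun k t => w (inr (k, t))) (margY p (sr x))).
Proof.
rewrite sum_sumpair /pairing -!sumrB; congr (_ + _); apply: eq_bigr => k _;
  by rewrite -sumrB; apply: eq_bigr => t _ /=; ring.
Qed.

Let Phi_fin x : (Phi x < +oo)%E -> exists c1 c2 : R,
  [/\ F1 (sx x) = c1%:E, F2 (sy x) = c2%:E,
      forall k z, 0 < pi z -> 0 <= sr x k z
    & Phi x = (c1 + c2 + eps * \sum_k \sum_z pi z * klf (sr x k z) (K k z))%:E].
Proof.
have := F1_gtNy (sx x); have := F2_gtNy (sy x); have := epsKL_gtNy (sr x).
rewrite /Phi; case E1 : (F1 _) => [c1||//]; case E2 : (F2 _) => [c2||//];
  case E3 : (_ * _)%E => [c3||//] _ _ _ // _.
exists c1, c2.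
have r0 : forall k z, 0 < pi z -> 0 <= sr x k z.
  apply: (KL_lty pi (sr x) K); move: E3; case: (KL _ _ _) => // [r _|]; first exact: ltry.
  by rewrite gt0_muley ?lte_fin.
by split => //; rewrite -E3 KL_fin // -EFinM -!EFinD.
Qed.

Let Phi_convex x y (t cx cy : R) : 0 < t < 1 ->
  (Phi x <= cx%:E)%E -> (Phi y <= cy%:E)%E ->
  (Phi (fun i => t * x i + (1 - t) * y i)%R <= (t * cx + (1 - t) * cy)%:E)%E.
Proof.
move=> t01 hx hy; have /andP[t0 t1] := t01.
have [a1 [a2 [E1 E2 rx Ex]]] := Phi_fin x (le_lt_trans hx (ltry _)).
have [b1 [b2 [D1 D2 ry Ey]]] := Phi_fin y (le_lt_trans hy (ltry _)).
case: hF1 hF2 => _ _ cv1 _ [_ _ cv2 _].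
have := cv1 (sx x) (sx y) t t01; rewrite E1 D1 -!EFinM -EFinD => h1.
have := cv2 (sy x) (sy y) t t01; rewrite E2 D2 -!EFinM -EFinD => h2.
rewrite /Phi KL_fin //; last first.
  by move=> k z pz; rewrite addr_ge0 // mulr_ge0 ?rx ?ry //; lra.
have := leeD h1 h2; rewrite -EFinD -EFinM => /leeD2r => h.
apply: (le_trans (h _)); rewrite -EFinD lee_fin.
move: hx hy; rewrite Ex Ey !lee_fin => /(ler_wpM2l (ltW t0)) hx hy.
have t1' : 0 <= 1 - t by lra.
have {}hy := ler_wpM2l t1' hy.
have hk : \sum_k \sum_z pi z * klf (t * sr x k z + (1 - t) * sr y k z) (K k z) <=
  t * \sum_k \sum_z pi z * klf (sr x k z) (K k z) +
  (1 - t) * \sum_k \sum_z pi z * klf (sr y k z) (K k z).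
  rewrite !mulr_sumr -big_split; apply: ler_sum => k _ /=.
  rewrite !mulr_sumr -big_split; apply: ler_sum => z _ /=.
  have [->|pz] := weight_cases _ pi0 z; first by rewrite !mul0r !mulr0 addr0.
  have := klf_convex _ _ _ t (rx k z pz) (ry k z pz) (K_gt0 k z pz) t01.
  by move=> /(ler_wpM2l (pi0 z)); lra.
have {}hk := ler_wpM2l (ltW eps_gt0) hk.
by move: hx hy hk; rewrite /sr; lra.
Qed.

Let Phi_lsc : box_lsc I Phi.
Proof.
apply: box_lscD.
- by move=> x; move: (F1_gtNy (sx x)) (F2_gtNy (sy x));
    case: (F1 _) => [?||//]; case: (F2 _) => [?||//] _ _; rewrite -?EFinD ?ltNyr.
- by move=> x; exact: epsKL_gtNy.
- apply: box_lscD => [x|x||]; [exact: F1_gtNy|exact: F2_gtNy| |].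
  + case: hF1 => _ _ _ /box_lsc_ptws.
    exact: (box_lsc_comp I _ (fun j => inl (inl j))).
  + case: hF2 => _ _ _ /box_lsc_ptws.
    exact: (box_lsc_comp I _ (fun j => inl (inr j))).
- have := box_lsc_KL n _ pi eps K pi0 eps_gt0 K_gt0.
  exact: (box_lsc_comp I _ (fun j => inr j)).
Qed.

Let L_linear t x y j :
  L (fun i => t * x i + (1 - t) * y i) j = t * L x j + (1 - t) * L y j.
Proof.
case: j => -[k s] /=; rewrite /margX /margY /sx /sy /sr.
- have -> : \sum_z q z * (t * x (inr (k, (s, z))) + (1 - t) * y (inr (k, (s, z)))) =
      t * \sum_z q z * x (inr (k, (s, z))) + (1 - t) * \sum_z q z * y (inr (k, (s, z))).
    by rewrite !mulr_sumr -big_split; apply: eq_bigr => z _ /=; ring.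
  by ring.
- have -> : \sum_z p z * (t * x (inr (k, (z, s))) + (1 - t) * y (inr (k, (z, s)))) =
      t * \sum_z p z * x (inr (k, (z, s))) + (1 - t) * \sum_z p z * y (inr (k, (z, s))).
    by rewrite !mulr_sumr -big_split; apply: eq_bigr => z _ /=; ring.
  by ring.
Qed.

Let L_lip x y (d : R) : (forall i, `|y i - x i| <= d) ->
  forall j, `|L y j - L x j| <= 2 * d.
Proof.
move=> h.
case=> -[k t] /=; apply: scaled_diff_lip => //; try exact: prob_weights_le1.
- exact: h.
- by apply: norm_average_le => // z; exact: h.
- exact: h.
- by apply: norm_average_le => // z; exact: h.
Qed.

Let sqn (y : J -> R) : R := \sum_j y j ^+ 2.
Let w1 (j : J) : R := match j with inl j => u1 j.1 j.2 | inr j => v1 j.1 j.2 end.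
Let mass (r : 'I_n -> X * Y -> R) : R := \sum_k \sum_z pi z * r k z.
Let slope : 'I_n -> X * Y -> R := fun k z => osum u1 v1 k z / eps + 1.
Let const : R := g1 + g2
  - eps * (\sum_k \sum_z pi z * (K k z * (expR (slope k z) - 1))) - sqn w1 / 2.

(** Add the affine minorants to Fenchel-Young with [slope]. Its u1, v1 part leaves only the
    residuals, absorbed by half of the penalty, and its summand 1 produces the mass of r. *)
Let Phi_coercive x : (Phi x < +oo)%E ->
  ((const + sqn (L x) / 2 + eps * mass (sr x))%:E <= Phi x + (sqn (L x))%:E)%E.
Proof.
move=> /Phi_fin [c1 [c2 [E1 E2 r0 ->]]].
rewrite -EFinD lee_fin.
have := F1_minorant (sx x); rewrite E1 lee_fin => h1.
have := F2_minorant (sy x); rewrite E2 lee_fin => h2.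
have hk : \sum_k \sum_z pi z * (slope k z * sr x k z) -
    \sum_k \sum_z pi z * (K k z * (expR (slope k z) - 1)) <=
    \sum_k \sum_z pi z * klf (sr x k z) (K k z).
  rewrite -sumrB; apply: ler_sum => k _; rewrite -sumrB; apply: ler_sum => z _.
  have [->|pz] := weight_cases _ pi0 z; first by rewrite !mul0r subr0.
  by rewrite -mulrBr ler_pM2l // klf_young ?r0 ?K_gt0.
have hs : eps * \sum_k \sum_z pi z * (slope k z * sr x k z) =
   pairing p u1 (margX q (sr x)) + pairing q v1 (margY p (sr x)) + eps * mass (sr x).
  rewrite (pairing_margX p) (pairing_margY p q) -pairingDl /pairing /mass.
  rewrite !mulr_sumr -big_split; apply: eq_bigr => k _ /=.
  rewrite !mulr_sumr -big_split; apply: eq_bigr => z _ /=.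
  rewrite /slope -/(osum u1 v1 k z).
  move: (osum u1 v1 k z) (sr x k z) (pi z) => a b c.
  by field; rewrite gt_eqF.
have {}hk := ler_wpM2l (ltW eps_gt0) hk.
have hL := sum_L w1 x; rewrite /w1 /= in hL.
have hq2 : \sum_j w1 j * L x j <= sqn (L x) / 2 + sqn w1 / 2.
  rewrite /sqn !mulr_suml -big_split; apply: ler_sum => j _ /=.
  by have := sqr_ge0 (L x j - w1 j); lra.
rewrite /const; rewrite /w1 /= in hq2 *; lra.
Qed.

Let mass_ge0 r : (forall k z, 0 < pi z -> 0 <= r k z) -> 0 <= mass r.
Proof.
move=> r0; do 2 (apply: sumr_ge0 => ? _).
match goal with |- is_true (0 <= pi ?z * _) => have [->|pz] := weight_cases _ pi0 z end.
  by rewrite mul0r.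
by rewrite mulr_ge0 ?r0.
Qed.

Let sqn_ge0 y : 0 <= sqn y.
Proof. by rewrite sumr_ge0 // => j _; rewrite sqr_ge0. Qed.

Let Phi_lbound x : (const%:E <= Phi x + (sqn (L x))%:E)%E.
Proof.
case E : (Phi x < +oo)%E; last first.
  by move/negbT: E; rewrite -leNgt leye_eq => /eqP ->; rewrite leey.
apply: le_trans (Phi_coercive x E); rewrite lee_fin.
have [c1 [c2 [_ _ r0 _]]] := Phi_fin x E.
have := mulr_ge0 (ltW eps_gt0) (mass_ge0 _ r0); have := sqn_ge0 (L x); lra.
Qed.

(** The representative that vanishes at null points, the only one for which bounds on weighted
    quantities bound every coordinate. *)
Let ae_zero (x : I -> R) (i : I) : R := match i with
  | inl (inl j) => if 0 < p j.2 then x i else 0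
  | inl (inr j) => if 0 < q j.2 then x i else 0
  | inr j => if 0 < pi j.2 then x i else 0 end.

Let Phi_ae_zero x : Phi (ae_zero x) = Phi x.
Proof.
case: hF1 hF2 => ae1 _ _ _ [ae2 _ _ _]; rewrite /Phi.
congr (_ + _ + _ * _)%E; [apply: ae1|apply: ae2|apply: KL_ae];
  by move=> // k t pt; rewrite /sx /sy /sr /= pt.
Qed.

Let L_ae_zero x j : L (ae_zero x) j = L x j.
Proof.
case: j => -[k t] /=; rewrite /sx /sy /margX /margY /sr /=.
- have [->|pt] := weight_cases _ p0 t; first by rewrite !mul0r.
  rewrite pt; congr (_ * (_ - _)); apply: eq_bigr => y _.
  have [->|qt] := weight_cases _ q0 y; first by rewrite !mul0r.
  by rewrite /prod_weights /= mulr_gt0.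
- have [->|pt] := weight_cases _ q0 t; first by rewrite !mul0r.
  rewrite pt; congr (_ * (_ - _)); apply: eq_bigr => y _.
  have [->|qt] := weight_cases _ p0 y; first by rewrite !mul0r.
  by rewrite /prod_weights /= mulr_gt0.
Qed.

Let Phi_bounded (c : R) : exists M : R, forall x,
  (Phi x + (sqn (L x))%:E <= c%:E)%E -> exists x', [/\ forall i, `|x' i| <= M,
    Phi x' = Phi x & forall j, L x' j = L x j].
Proof.
pose H := c - const.
have [d1 d10 hd1] := finite_pos_lbound _ p.
have [d2 d20 hd2] := finite_pos_lbound _ q.
have [d3 d30 hd3] := finite_pos_lbound _ pi.
pose B := 1 + 2 * H + H / eps.
exists (B * (d1^-1 + d2^-1 + d3^-1)) => x hx; exists (ae_zero x).
split; [|exact: Phi_ae_zero|exact: L_ae_zero].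
have Pfin : (Phi x < +oo)%E.
  by move: hx; case: (Phi x) => [a||] //= _; rewrite ltry.
have [c1 [c2 [_ _ r0 _]]] := Phi_fin x Pfin.
have h := le_trans (Phi_coercive x Pfin) hx; rewrite lee_fin in h.
have m0 := mass_ge0 _ r0; have s0 := sqn_ge0 (L x).
have em0 := mulr_ge0 (ltW eps_gt0) m0.
have H0 : 0 <= H by rewrite /H; lra.
have HL j : `|L x j| <= 1 + 2 * H.
  have : L x j ^+ 2 <= 2 * H.
    apply: (@le_trans _ _ (sqn (L x))); last by rewrite /H; lra.
    by rewrite /sqn (bigD1 j) //= lerDl sumr_ge0 // => i _; rewrite sqr_ge0.
  by rewrite -real_normK ?num_real //; have := normr_ge0 (L x j); nra.
have Hm : mass (sr x) <= H / eps by rewrite ler_pdivlMr // mulrC /H; lra.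
have He : 0 <= H / eps by exact: le_trans m0 Hm.
have B0 : 0 <= B by rewrite /B; lra.
have i1 : 0 <= d1^-1 by rewrite invr_ge0 ltW.
have i2 : 0 <= d2^-1 by rewrite invr_ge0 ltW.
have i3 : 0 <= d3^-1 by rewrite invr_ge0 ltW.
have M0 : 0 <= B * (d1^-1 + d2^-1 + d3^-1) by rewrite mulr_ge0 // !addr_ge0.
have aux (m d a : R) : 0 < d -> d <= m -> d^-1 <= d1^-1 + d2^-1 + d3^-1 ->
    `|m * a| <= B -> `|a| <= B * (d1^-1 + d2^-1 + d3^-1).
  move=> dp dm hd; have mp : 0 < m by exact: lt_le_trans dm.
  rewrite normrM gtr0_norm // => ha.
  apply: (@le_trans _ _ (B * d^-1)); last by rewrite ler_wpM2l.
  rewrite ler_pdivlMr // mulrC; apply: le_trans ha.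
  by rewrite ler_wpM2r.
have pr0 k z : 0 <= pi z * sr x k z.
  have [->|pz] := weight_cases _ pi0 z; first by rewrite mul0r.
  by rewrite mulr_ge0 ?r0.
have row_le k : \sum_z pi z * sr x k z <= mass (sr x).
  by rewrite /mass (bigD1 k) //= lerDl; do 2 (apply: sumr_ge0 => ? _).
have rowE k : \sum_z pi z * sr x k z = \sum_t \sum_y p t * q y * sr x k (t, y).
  by rewrite pair_bigA; apply: eq_bigr => -[].
move=> i; case: i => [[[k t]|[k t]]|[k z]] /=.
- case: ifP => [pt|_]; last by rewrite normr0.
  apply: (aux (p t) d1) => //; [exact: hd1|lra|].
  have -> : p t * x (inl (inl (k, t))) = L x (inl (k, t)) + p t * margX q (sr x) k t.
    by rewrite /L /sx /=; ring.
  apply: le_trans (ler_normD _ _) _; rewrite /B; apply: lerD; first exact: HL.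
  apply: le_trans Hm; rewrite ger0_norm /margX; last first.
    rewrite mulr_sumr; apply: sumr_ge0 => y _; rewrite mulrA; exact: (pr0 k (t, y)).
  apply: le_trans (row_le k); rewrite rowE (bigD1 t) //= mulr_sumr.
  have -> : \sum_y p t * (q y * sr x k (t, y)) = \sum_y p t * q y * sr x k (t, y).
    by apply: eq_bigr => y _; rewrite mulrA.
  by rewrite lerDl; apply: sumr_ge0 => a _; apply: sumr_ge0 => y _; exact: (pr0 k (a, y)).
- case: ifP => [pt|_]; last by rewrite normr0.
  apply: (aux (q t) d2) => //; [exact: hd2|lra|].
  have -> : q t * x (inl (inr (k, t))) = L x (inr (k, t)) + q t * margY p (sr x) k t.
    by rewrite /L /sy /=; ring.
  apply: le_trans (ler_normD _ _) _; rewrite /B; apply: lerD; first exact: HL.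
  apply: le_trans Hm; rewrite ger0_norm /margY; last first.
    rewrite mulr_sumr; apply: sumr_ge0 => y _; rewrite mulrA [q t * _]mulrC.
    exact: (pr0 k (y, t)).
  apply: le_trans (row_le k); rewrite rowE exchange_big (bigD1 t) //= mulr_sumr.
  have -> : \sum_y q t * (p y * sr x k (y, t)) = \sum_y p y * q t * sr x k (y, t).
    by apply: eq_bigr => y _; ring.
  by rewrite lerDl; apply: sumr_ge0 => a _; apply: sumr_ge0 => y _; exact: (pr0 k (y, a)).
- case: ifP => [pz|_]; last by rewrite normr0.
  apply: (aux (pi z) d3) => //; [exact: hd3|lra|].
  rewrite ger0_norm; last exact: (pr0 k z).
  apply: (@le_trans _ _ (mass (sr x))); last by rewrite /B; lra.
  apply: le_trans (row_le k); rewrite (bigD1 z) //= lerDl.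
  by apply: sumr_ge0 => a _; exact: pr0.
Qed.

Let P_le_Phi x : (forall j, L x j = 0) -> (P%:E <= Phi x)%E.
Proof.
move=> Lx0; apply: le_trans (P_le (sr x)) _; rewrite /primal /Phi.
case: hF1 hF2 => ae1 _ _ _ [ae2 _ _ _].
rewrite (ae1 (sx x) (margX q (sr x))); last first.
  move=> k t pt; apply/eqP; rewrite -subr_eq0.
  have /eqP := Lx0 (inl (k, t)).
  by rewrite /= mulf_eq0 gt_eqF.
rewrite (ae2 (sy x) (margY p (sr x))) // => k t pt; apply/eqP; rewrite -subr_eq0.
by have /eqP := Lx0 (inr (k, t)); rewrite /= mulf_eq0 gt_eqF.
Qed.

Let join s t r (i : I) : R := match i with
  | inl (inl j) => s j.1 j.2 | inl (inr j) => t j.1 j.2 | inr j => r j.1 j.2 end.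

Lemma strong_duality (delta : R) : 0 < delta ->
  exists u v, (neg_dual p q F1 F2 K eps u v <= (- P + delta)%:E)%E.
Proof.
move=> delta0.
have Phi_finite : exists x, (Phi x < +oo)%E.
  by have [r hr] := primal_finite; exists (join (margX q r) (margY p r) r).
have [w hw] := approx_multiplier Phi L 2 const P Phi_lsc Phi_convex Phi_finite
  (ltr0n _ _) L_linear L_lip Phi_lbound Phi_bounded P_le_Phi delta delta0.
pose u k t := w (inl (k, t)); pose v k t := w (inr (k, t)).
exists u, v; rewrite /neg_dual.
pose E := eps * pairing pi (fun k z => expR (osum u v k z / eps) - 1) K.
have -> : (- P + delta)%:E = (- P + delta - E + E)%:E by rewrite subrK.
rewrite EFinD leeD2r //; apply: conjugate_sum_le => // s t c1 c2 E1 E2.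
have g0 k z : 0 < pi z -> 0 <= gibbs K eps u v k z by move=> pz; exact/ltW/(gibbs_gt0 p q).
(* The multiplier inequality is tested at r = gibbs, where the entropy attains its conjugate, so
   only the conjugates of F1 and F2 remain to be bounded. *)
have := hw (join s t (gibbs K eps u v)); rewrite sum_L /Phi.
change (sx (join s t (gibbs K eps u v))) with s.
change (sy (join s t (gibbs K eps u v))) with t.
change (sr (join s t (gibbs K eps u v))) with (gibbs K eps u v).
rewrite E1 E2 KL_fin // -EFinM -!EFinD lee_fin -/u -/v !pairingNl.
have := pairing_gibbs p q K eps eps_gt0 hp hq K_gt0 u v; rewrite -/E.
lra.
Qed.

End StrongDuality.
(** * Scaling iterates *)

Section Iterates.
Context {R : realType} {n : nat} {X Y : finType}.
Variables (p : X -> R) (q : Y -> R).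
Variables (F1 : ('I_n -> X -> R) -> \bar R) (F2 : ('I_n -> Y -> R) -> \bar R).
Variables (K : 'I_n -> X * Y -> R) (eps : R).
Hypotheses (eps_gt0 : 0 < eps) (hp : prob_weights p) (hq : prob_weights q).
Hypotheses (hF1 : convex_functional p F1) (hF2 : convex_functional q F2).
Hypothesis K_gt0 : ae_pos (prod_weights p q) K.
Local Notation pi := (prod_weights p q).
Local Notation ae_eq := Defs.ae_eq.

Implicit Types (a : 'I_n -> X -> R) (b : 'I_n -> Y -> R) (r : 'I_n -> X * Y -> R).

Lemma average_gt0 (T : finType) (m f : T -> R) : prob_weights m ->
  (forall t, 0 < m t -> 0 < f t) -> 0 < \sum_t m t * f t.
Proof.
move=> [m0 m1] f0.
have ge0 t : 0 <= m t * f t.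
  by have [->|mt] := weight_cases _ m0 t; rewrite ?mul0r // mulr_ge0 ?m0 // ltW ?f0.
rewrite lt_neqAle sumr_ge0 // andbT eq_sym; apply/eqP => /eqP.
rewrite psumr_eq0 // => /allP h.
have : (1 : R) = 0.
  rewrite -m1 big1 // => t _; have := h t; rewrite mem_index_enum => /(_ isT) /eqP.
  have [->//|mt] := weight_cases _ m0 t.
  by move/eqP; rewrite mulf_eq0 !gt_eqF ?f0.
by move/eqP; rewrite oner_eq0.
Qed.

Lemma expR_scaled_ln (x y : R) : 0 < x -> 0 < y ->
  expR ((eps * ln x + eps * ln y) / eps) = x * y.
Proof.
move=> x0 y0; rewrite -mulrDr mulrAC divff ?gt_eqF // mul1r expRD.
by rewrite !lnK.
Qed.

Lemma coupling_gibbs a b : ae_pos p a -> ae_pos q b ->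
  ae_eq pi (coupling K a b) (gibbs K eps (scaled_log eps a) (scaled_log eps b)).
Proof.
move=> a0 b0 k z pz; rewrite /coupling /gibbs /osum /scaled_log.
have [pz1 pz2] : 0 < p z.1 /\ 0 < q z.2.
  have := pz; rewrite /prod_weights.
  have [->|p1] := weight_cases _ hp.1 z.1; first by rewrite mul0r ltxx.
  have [->|p2] := weight_cases _ hq.1 z.2; first by rewrite mulr0 ltxx.
  by [].
by rewrite expR_scaled_ln ?a0 ?b0 //; ring.
Qed.

Lemma margX_coupling a b k x : margX q (coupling K a b) k x = a k x * Kop q K b k x.
Proof. by rewrite /margX /Kop mulr_sumr; apply: eq_bigr => y _; rewrite /coupling /=; ring. Qed.

Lemma margY_coupling a b k y : margY p (coupling K a b) k y = b k y * KopT p K a k y.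
Proof. by rewrite /margY /KopT mulr_sumr; apply: eq_bigr => x _; rewrite /coupling /=; ring. Qed.

Lemma margX_ae r r' : ae_eq pi r r' -> ae_eq p (margX q r) (margX q r').
Proof.
move=> h k x px; apply: eq_bigr => y _.
have [->|qy] := weight_cases _ hq.1 y; first by rewrite !mul0r.
by rewrite h // mulr_gt0.
Qed.

Lemma margY_ae r r' : ae_eq pi r r' -> ae_eq q (margY p r) (margY p r').
Proof.
move=> h k y qy; apply: eq_bigr => x _.
have [->|px] := weight_cases _ hp.1 x; first by rewrite !mul0r.
by rewrite h // mulr_gt0.
Qed.

(** Since a = s / Kop b, the prox point s is the X-marginal of the coupling and eps ln (s / Kop b)
    is the dual iterate, so this is [prox_subgradient] in dual variables. *)
Lemma scaling_subgradX a b s : ae_pos p a -> ae_pos q b ->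
  is_prox p F1 eps (Kop q K b) s ->
  ae_eq p a (fun k x => s k x / Kop q K b k x) ->
  exists c, subgradient p F1 (fun k x => - scaled_log eps a k x)
    (margX q (gibbs K eps (scaled_log eps a) (scaled_log eps b))) c.
Proof.
move=> a0 b0 sprox sa.
have z0 : ae_pos p (Kop q K b).
  by move=> k x px; apply: average_gt0 => // y qy; rewrite mulr_gt0 ?b0 ?K_gt0 ?mulr_gt0.
have sE : ae_eq p s (margX q (coupling K a b)).
  by move=> k x px; rewrite margX_coupling sa // divfK // gt_eqF // z0.
have s0 : ae_pos p s.
  by move=> k x px; rewrite sE // margX_coupling mulr_gt0 ?a0 ?z0.
have [c sub] := prox_subgradient p hp.1 F1 eps _ _ hF1 eps_gt0 z0 s0 sprox.
exists c; case: hF1 => ae1 _ _ _; apply: subgradient_ae sub => //; first exact: hp.1.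
  by move=> k x px; rewrite /scaled_log sa.
move=> k x px; rewrite sE //; apply: margX_ae => //; exact: coupling_gibbs.
Qed.

Lemma scaling_subgradY a b s : ae_pos p a -> ae_pos q b ->
  is_prox q F2 eps (KopT p K a) s ->
  ae_eq q b (fun k y => s k y / KopT p K a k y) ->
  exists c, subgradient q F2 (fun k y => - scaled_log eps b k y)
    (margY p (gibbs K eps (scaled_log eps a) (scaled_log eps b))) c.
Proof.
move=> a0 b0 sprox sb.
have z0 : ae_pos q (KopT p K a).
  by move=> k y qy; apply: average_gt0 => // x px; rewrite mulr_gt0 ?a0 ?K_gt0 ?mulr_gt0.
have sE : ae_eq q s (margY p (coupling K a b)).
  by move=> k y qy; rewrite margY_coupling sb // divfK // gt_eqF // z0.
have s0 : ae_pos q s.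
  by move=> k y qy; rewrite sE // margY_coupling mulr_gt0 ?b0 ?z0.
have [c sub] := prox_subgradient q hq.1 F2 eps _ _ hF2 eps_gt0 z0 s0 sprox.
exists c; case: hF2 => ae2 _ _ _; apply: subgradient_ae sub => //; first exact: hq.1.
  by move=> k y qy; rewrite /scaled_log sb.
move=> k y qy; rewrite sE //; apply: margY_ae => //; exact: coupling_gibbs.
Qed.

Lemma neg_dual_fin u v (x : R) : neg_dual p q F1 F2 K eps u v = x%:E ->
  exists c1 c2 : R, [/\ conjugate p F1 (fun k t => - u k t) = c1%:E,
    conjugate q F2 (fun k t => - v k t) = c2%:E
   & x = c1 + c2 + eps * pairing pi (fun k z => expR (osum u v k z / eps) - 1) K].
Proof.
case: hF1 hF2 => _ pr1 _ _ [_ pr2 _ _]; rewrite /neg_dual.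
have := conjugate_gtNy p _ (fun k x => - u k x) pr1.
have := conjugate_gtNy q _ (fun k x => - v k x) pr2.
case: (conjugate q _ _) => [c2||//] _; case: (conjugate p _ _) => [c1||//] _ //.
by rewrite -!EFinD => -[<-]; exists c1, c2.
Qed.

End Iterates.

(** * The optimal dual value and the primal minimizer *)

Section OptimalPair.
Context {R : realType} {n : nat} {X Y : finType}.
Variables (p : X -> R) (q : Y -> R).
Variables (F1 : ('I_n -> X -> R) -> \bar R) (F2 : ('I_n -> Y -> R) -> \bar R).
Variables (K : 'I_n -> X * Y -> R) (eps : R).
Hypotheses (eps_gt0 : 0 < eps) (hp : prob_weights p) (hq : prob_weights q).
Hypotheses (hF1 : convex_functional p F1) (hF2 : convex_functional q F2).
Hypothesis K_gt0 : ae_pos (prod_weights p q) K.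
Variable (rstar : 'I_n -> X * Y -> R).
Hypothesis hrstar : is_argmin (primal p q F1 F2 K eps) rstar.
Local Notation pi := (prod_weights p q).
Local Notation I := (neg_dual p q F1 F2 K eps).
Let rstar_ge0 : forall k z, 0 < pi z -> 0 <= rstar k z.
Proof. by have [? [? []]] := primal_fin p q F1 F2 K eps eps_gt0 hp hq hF1 hF2 K_gt0 _ hrstar.1. Qed.

Lemma KL_gibbs_fin u v : KL pi rstar (gibbs K eps u v) =
  (\sum_k \sum_z pi z * klf (rstar k z) (gibbs K eps u v k z))%:E.
Proof. by apply: KL_fin => //; exact: gibbs_gt0. Qed.

(** P is the primal minimum. Weak duality gives the remainder bound; the two subgradients supply the
    affine minorants for [strong_duality], which closes the gap. *)
Lemma inf_neg_dual_primal u1 v1 s1 t1 (c1 c2 : R) :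
  subgradient p F1 (fun k x => - u1 k x) s1 c1 ->
  subgradient q F2 (fun k y => - v1 k y) t1 c2 ->
  exists P : R, inf_neg_dual p q F1 F2 K eps = (- P)%:E /\
   forall u v, ((- P)%:E + eps%:E * KL pi rstar (gibbs K eps u v) <= I u v)%E.
Proof.
move=> [_ sub1] [_ sub2].
have [d1 [d2 [E1 E2 r0 EP]]] :=
  primal_fin p q F1 F2 K eps eps_gt0 hp hq hF1 hF2 K_gt0 _ hrstar.1.
set P := (X in X%:E) in EP; exists P.
have lb u v : ((- P)%:E + eps%:E * KL pi rstar (gibbs K eps u v) <= I u v)%E.
  rewrite KL_gibbs_fin -EFinM -EFinD addrC.
  exact: neg_dual_lbound.
split => //; apply/eqP; rewrite eq_le; apply/andP; split.
  apply/lee_addgt0Pr => delta d0; rewrite -EFinD.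
  have [||||u [v huv]] := strong_duality p q F1 F2 K eps eps_gt0 hp hq hF1 hF2 K_gt0 u1 v1
    (c1 + pairing p u1 s1) (c2 + pairing q v1 t1) P _ _ _ _ delta d0.
  - by move=> s; have := sub1 s; rewrite !pairingNl opprK addrAC.
  - by move=> t; have := sub2 t; rewrite !pairingNl opprK addrAC.
  - by move=> r; rewrite -EP; exact: hrstar.2.
  - by exists rstar; exact: hrstar.1.
  by apply: le_trans huv; apply: ereal_inf_lbound; exists (u, v).
apply: le_ereal_inf_tmp => _ [[u v] _ <-]; apply: le_trans (lb u v).
rewrite leeDl // mule_ge0 ?lee_fin ?(ltW eps_gt0) //.
by apply: KL_ge0 => [z|]; [exact: prod_weights_ge0|exact: gibbs_gt0].
Qed.

(* The lower bound of [inf_neg_dual_primal] is attained, so its KL term is 0. *)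
Lemma rstar_gibbs u0 v0 (P : R) : I u0 v0 = (- P)%:E ->
  ((- P)%:E + eps%:E * KL pi rstar (gibbs K eps u0 v0) <= I u0 v0)%E ->
  Defs.ae_eq pi rstar (gibbs K eps u0 v0).
Proof.
move=> ->; rewrite KL_gibbs_fin -EFinM -EFinD lee_fin => h.
have g0 := gibbs_gt0 p q K eps K_gt0 u0 v0.
have ge0 k z : 0 <= pi z * klf (rstar k z) (gibbs K eps u0 v0 k z).
  have [->|pz] := weight_cases _ (prod_weights_ge0 p q hp hq) z; first by rewrite mul0r.
  by rewrite mulr_ge0 ?klf_ge0 ?rstar_ge0 ?g0 // ltW.
have : \sum_k \sum_z pi z * klf (rstar k z) (gibbs K eps u0 v0 k z) <= 0.
  by rewrite -(pmulr_rle0 _ eps_gt0); lra.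
move=> s0 k z pz; apply: klf_eq0; [exact: rstar_ge0|exact: g0|].
apply/eqP; rewrite eq_le klf_ge0 ?rstar_ge0 ?g0 // andbT -(pmulr_rle0 _ pz).
apply: le_trans s0; rewrite (bigD1 k) //= (bigD1 z) //= -addrA lerDl addr_ge0 //.
  by apply: sumr_ge0 => z' _; exact: ge0.
by do 2 (apply: sumr_ge0 => ? _); exact: ge0.
Qed.

End OptimalPair.

(** * Iterates relative to a reference dual pair *)

Section RelativeSums.
Context {R : realType} {n : nat} {X Y : finType}.
Variables (p : X -> R) (q : Y -> R) (K : 'I_n -> X * Y -> R) (eps : R).
Hypothesis eps_gt0 : 0 < eps.
Local Notation pi := (prod_weights p q).
Variables (u0 : 'I_n -> X -> R) (v0 : 'I_n -> Y -> R).

(** The indices k and (x, y) are merged into one finite type, as the abstract scheme requires. *)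
Definition gibbs_weights (j : 'I_n * (X * Y)) : R := pi j.2 * gibbs K eps u0 v0 j.1 j.2.

Definition relX (u : 'I_n -> X -> R) (j : 'I_n * (X * Y)) : R :=
  (u j.1 j.2.1 - u0 j.1 j.2.1) / eps.

Definition relY (v : 'I_n -> Y -> R) (j : 'I_n * (X * Y)) : R :=
  (v j.1 j.2.2 - v0 j.1 j.2.2) / eps.

Lemma gibbs_shift u v k z : gibbs K eps u v k z =
  gibbs K eps u0 v0 k z * expR (relX u (k, z) + relY v (k, z)).
Proof.
rewrite /gibbs -mulrA -expRD /osum /relX /relY /=; congr (_ * expR _).
by rewrite -!mulrDl; congr (_ / _); ring.
Qed.

Lemma sum_gibbs_weights (f : 'I_n * (X * Y) -> R) :
  \sum_j gibbs_weights j * f j =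
  \sum_k \sum_z pi z * (gibbs K eps u0 v0 k z * f (k, z)).
Proof.
by rewrite pair_bigA; apply: eq_bigr => -[k z] _; rewrite /gibbs_weights mulrA.
Qed.

Lemma pairing_expR_rel u v :
  pairing pi (fun k z => expR (osum u v k z / eps) - 1) K
  - pairing pi (fun k z => expR (osum u0 v0 k z / eps) - 1) K =
  \sum_j gibbs_weights j * (expR (relX u j + relY v j) - 1).
Proof.
rewrite sum_gibbs_weights /pairing -sumrB; apply: eq_bigr => k _.
rewrite -sumrB; apply: eq_bigr => z _.
have := gibbs_shift u v k z.
rewrite mulrBr mulr1 => <-; rewrite /gibbs; ring.
Qed.

Lemma pairing_relX u u' v' :
  pairing p (fun k x => u k x - u' k x) (margX q (gibbs K eps u v')) =
  eps * \sum_j gibbs_weights j * (expR (relX u j + relY v' j) * (relX u j - relX u' j)).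
Proof.
rewrite pairing_margX sum_gibbs_weights /pairing mulr_sumr; apply: eq_bigr => k _.
rewrite mulr_sumr; apply: eq_bigr => z _.
rewrite [gibbs K eps u0 v0 k z * _]mulrA -gibbs_shift /relX /=.
by field; rewrite gt_eqF.
Qed.

Lemma pairing_relY u' v v' :
  pairing q (fun k y => v k y - v' k y) (margY p (gibbs K eps u' v)) =
  eps * \sum_j gibbs_weights j * (expR (relX u' j + relY v j) * (relY v j - relY v' j)).
Proof.
rewrite (pairing_margY p) sum_gibbs_weights /pairing mulr_sumr; apply: eq_bigr => k _.
rewrite mulr_sumr; apply: eq_bigr => z _.
rewrite [gibbs K eps u0 v0 k z * _]mulrA -gibbs_shift /relY /=.
by field; rewrite gt_eqF.
Qed.

Lemma KL_gibbs_rel u v :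
  \sum_k \sum_z pi z * klf (gibbs K eps u0 v0 k z) (gibbs K eps u v k z) =
  \sum_j gibbs_weights j * (expR (relX u j + relY v j) - 1 - (relX u j + relY v j)).
Proof.
rewrite sum_gibbs_weights; apply: eq_bigr => k _; apply: eq_bigr => z _.
have [g0|g0] := eqVneq (gibbs K eps u0 v0 k z) 0.
  by rewrite (gibbs_shift u v) g0 !mul0r klf0.
rewrite (gibbs_shift u v); move: (gibbs K eps u0 v0 k z) g0 => g g0; congr (_ * _).
rewrite /klf; move: (relX u (k, z) + relY v (k, z)) => w.
have -> : g / (g * expR w) = expR (- w).
  by rewrite expRN; field; rewrite g0 gt_eqF ?expR_gt0.
by rewrite expRK; ring.
Qed.

End RelativeSums.

(** Subgradients invert under conjugation: s is a subgradient of the conjugate at -u, tested here at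
    -u'. *)
Lemma subgradient_conjugate_le {R : realType} {n : nat} {T : finType} (p : T -> R)
    (F : ('I_n -> T -> R) -> \bar R) u u' s (c x x' : R) :
  subgradient p F (fun k t => - u k t) s c ->
  conjugate p F (fun k t => - u k t) = x%:E ->
  conjugate p F (fun k t => - u' k t) = x'%:E ->
  pairing p (fun k t => u k t - u' k t) s <= x' - x.
Proof.
move=> sub; rewrite (subgradient_conjugate _ _ _ _ _ sub) => -[<-] E'.
have := conjugate_ge p F (fun k t => - u' k t) s c sub.1.
rewrite E' lee_fin (pairingDl p u (fun k t => - u' k t)) !pairingNl; lra.
Qed.

(** * Both inequalities for the scaling iterates *)

Theorem theorem4p1 (R : realType) (n : nat) (X Y : finType)
    (p : X -> R) (q : Y -> R)
    (F1 : ('I_n -> X -> R) -> \bar R) (F2 : ('I_n -> Y -> R) -> \bar R)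
    (K : 'I_n -> X * Y -> R) (eps : R) (v0 : 'I_n -> Y -> R)
    (a : nat -> 'I_n -> X -> R) (b : nat -> 'I_n -> Y -> R)
    (rstar : 'I_n -> X * Y -> R)
    (n_ge1 : (1 <= n)%N) (eps_gt0 : 0 < eps)
    (hp : prob_weights p) (hq : prob_weights q)
    (hF1 : convex_functional p F1) (hF2 : convex_functional q F2)
    (K_gt0 : ae_pos (prod_weights p q) K)
    (hab : scaling_iterates p q F1 F2 K eps v0 a b)
    (* the dual iterates are finite, i.e. belong to L^oo *)
    (a_gt0 : forall l : nat, ae_pos p (a l.+1))
    (b_gt0 : forall l : nat, ae_pos q (b l.+1))
    (hrstar : is_argmin (primal p q F1 F2 K eps) rstar) :
  let gap l := (neg_dual p q F1 F2 K eps
                  (scaled_log eps (a l)) (scaled_log eps (b l))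
                - inf_neg_dual p q F1 F2 K eps)%E in
  (forall l : nat, (1 <= l)%N ->
     (eps%:E * KL (prod_weights p q) rstar (coupling K (a l) (b l))
        <= gap l)%E) /\
  (dual_attained p q F1 F2 K eps ->
     exists C : R, forall l : nat, (1 <= l)%N -> (gap l <= (C / l%:R)%:E)%E).
Proof.
move=> gap; have [hb0 hstep] := hab.
have b_pos l : ae_pos q (b l).
  by case: l => [|l]; [move=> k y qy; rewrite hb0 // expR_gt0|exact: b_gt0].
pose ua l := scaled_log eps (a l); pose vb l := scaled_log eps (b l).
have /choice [cX subX] l : exists c, subgradient p F1 (fun k x => - ua l.+1 k x)
    (margX q (gibbs K eps (ua l.+1) (vb l))) c.
  have [[s hs sE] _] := hstep l; exact: scaling_subgradX hs sE.
have /choice [cY subY] l : exists c, subgradient q F2 (fun k y => - vb l.+1 k y)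
    (margY p (gibbs K eps (ua l.+1) (vb l.+1))) c.
  have [_ [t ht tE]] := hstep l; exact: scaling_subgradY ht tE.
have [P [infE lb]] := inf_neg_dual_primal p q F1 F2 K eps eps_gt0 hp hq hF1 hF2 K_gt0
  rstar hrstar _ _ _ _ _ _ (subX 0%N) (subY 0%N).
split=> [[//|l] _|[u0 [v0' E0]]].
  rewrite /gap infE leeBrDr // addeC.
  rewrite (KL_ae _ (prod_weights_ge0 p q hp hq) _ rstar _
    (gibbs K eps (ua l.+1) (vb l.+1))) //.
  exact: coupling_gibbs.
rewrite infE in E0.
have rE := rstar_gibbs p q F1 F2 K eps eps_gt0 hp hq hF1 hF2 K_gt0 rstar hrstar
  u0 v0' P E0 (lb u0 v0').
have [A0 [B0 [EA0 EB0 EP]]] := neg_dual_fin p q F1 F2 K eps hF1 hF2 u0 v0' _ E0.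
pose A l := pairing p (fun k x => - ua l.+1 k x) (margX q (gibbs K eps (ua l.+1) (vb l))) - cX l.
have EA l : conjugate p F1 (fun k x => - ua l.+1 k x) = (A l)%:E.
  exact: subgradient_conjugate (subX l).
pose B l := pairing q (fun k y => - vb l.+1 k y) (margY p (gibbs K eps (ua l.+1) (vb l.+1))) - cY l.
have EB l : conjugate q F2 (fun k y => - vb l.+1 k y) = (B l)%:E.
  exact: subgradient_conjugate (subY l).
pose rho := gibbs_weights p q K eps u0 v0'.
(* Index l of the abstract scheme is iterate l + 1: at the starting point v0, the conjugate of F2
   may be infinite. *)
pose e l : 'I_n * (X * Y) -> R := relX eps u0 (ua l.+1).
pose d l : 'I_n * (X * Y) -> R := relY eps v0' (vb l.+1).
have rel0X (j : 'I_n * (X * Y)) : relX eps u0 u0 j = 0 by rewrite /relX subrr mul0r.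
have rel0Y (j : 'I_n * (X * Y)) : relY eps v0' v0' j = 0 by rewrite /relY subrr mul0r.
have pair_rel l m :
  eps * pairing (prod_weights p q) (fun k z => expR (osum (ua l.+1) (vb m.+1) k z / eps) - 1) K =
  eps * pairing (prod_weights p q) (fun k z => expR (osum u0 v0' k z / eps) - 1) K +
  eps * \sum_j rho j * (expR (e l j + d m j) - 1).
  by rewrite /rho -(pairing_expR_rel p q K eps u0 v0'); ring.
have rho_ge0 j : 0 <= rho j.
  have [pj|pj] := weight_cases _ (prod_weights_ge0 p q hp hq) j.2.
    by rewrite /rho /gibbs_weights pj mul0r.
  by rewrite mulr_ge0 ?prod_weights_ge0 // ltW // (gibbs_gt0 p q).
(* In the weak duality bound [lb], KL(rstar | r) is the sum of rho (e^z - 1 - z); its e^z - 1 part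
   cancels with that of I. *)
have lbound l m : - (\sum_j rho j * (e l j + d m j)) <= (A l - A0) / eps + (B m - B0) / eps.
  have := lb (ua l.+1) (vb m.+1); rewrite /neg_dual EA EB.
  rewrite (KL_ae _ (prod_weights_ge0 p q hp hq) _ (gibbs K eps u0 v0') _
    (gibbs K eps (ua l.+1) (vb m.+1))) // KL_fin; last first.
  - exact: gibbs_gt0.
  - by move=> k z pz; rewrite ltW // (gibbs_gt0 p q).
  rewrite KL_gibbs_rel // -EFinM -!EFinD lee_fin [X in _ <= _ + X](pair_rel l m) EP.
  have -> : \sum_j rho j * (expR (e l j + d m j) - 1 - (e l j + d m j)) =
      \sum_j rho j * (expR (e l j + d m j) - 1) - \sum_j rho j * (e l j + d m j).
    by rewrite -sumrB; apply: eq_bigr => j _; ring.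
  rewrite -mulrDl ler_pdivlMr //; lra.
have slope_e l : \sum_j rho j * (expR (e l.+1 j + d l j) * (e l.+1 j - e l j))
    <= (A l - A0) / eps - (A l.+1 - A0) / eps.
  have := subgradient_conjugate_le p F1 _ (ua l.+1) _ _ _ _ (subX l.+1) (EA l.+1) (EA l).
  rewrite (pairing_relX p q K eps eps_gt0 u0 v0') -mulrBl ler_pdivlMr // mulrC.
  by rewrite -/e -/d -/rho; lra.
have slope_e0 l : \sum_j rho j * (expR (e l.+1 j + d l j) * e l.+1 j)
    <= - ((A l.+1 - A0) / eps).
  have := subgradient_conjugate_le p F1 _ u0 _ _ _ _ (subX l.+1) (EA l.+1) EA0.
  rewrite (pairing_relX p q K eps eps_gt0 u0 v0') -mulNr ler_pdivlMr // mulrC.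
  under eq_bigr do rewrite rel0X subr0.
  by rewrite -/e -/d -/rho; lra.
have slope_d l : \sum_j rho j * (expR (e l.+1 j + d l.+1 j) * (d l.+1 j - d l j))
    <= (B l - B0) / eps - (B l.+1 - B0) / eps.
  have := subgradient_conjugate_le q F2 _ (vb l.+1) _ _ _ _ (subY l.+1) (EB l.+1) (EB l).
  rewrite (pairing_relY p q K eps eps_gt0 u0 v0') -mulrBl ler_pdivlMr // mulrC.
  by rewrite -/e -/d -/rho; lra.
have slope_d0 l : \sum_j rho j * (expR (e l j + d l j) * d l j) <= - ((B l - B0) / eps).
  have := subgradient_conjugate_le q F2 _ v0' _ _ _ _ (subY l) (EB l) EB0.
  rewrite (pairing_relY p q K eps eps_gt0 u0 v0') -mulNr ler_pdivlMr // mulrC.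
  under eq_bigr do rewrite rel0Y subr0.
  by rewrite -/e -/d -/rho; lra.
have [C hC] := alternating_rate rho e d (fun l => (A l - A0) / eps)
  (fun l => (B l - B0) / eps) rho_ge0 lbound slope_e slope_e0 slope_d slope_d0.
(* The scheme's gap is divided by eps, and its bound C / l.+1 at index l concerns iterate l + 1. *)
exists (eps * C) => -[//|l] _; rewrite /gap infE /neg_dual EA EB.
rewrite -EFinN -!EFinD lee_fin [X in _ + X - _](pair_rel l l) EP -mulrA.
have := ler_wpM2l (ltW eps_gt0) (hC l); rewrite !mulrDr ![eps * (_ / eps)]mulrC.
rewrite !divfK ?gt_eqF //.
set S := \sum_j rho j * (expR (e l j + d l j) - 1); set Q := pairing _ _ K.
by apply: le_trans; rewrite le_eqVlt; apply/orP; left; apply/eqP; rewrite -/S; ring.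
Qed.
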